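(* Let $\mathbf G<\mathrm{SL}(n,\mathbb C)$ be a connected semisimple algebraic group defined over $\overline{\mathbb Q}^r$. Let $F$ be a finite generating set of a group $\Gamma$ with $|F|=f$, let $E:=F^{2^n-1}\subset\Gamma$, and $m=\mathrm{lcm}\{1,\dots,2^n-1\}$. Then there exists $c_1=c_1(f,n)$ such that for any representation $\rho:\Gamma\to\mathbf G(\mathbb R)$ with $(\rho(\gamma))_{\gamma\in F}$ minimal, the inequality $$\left(\sum_{\gamma\in F}\mathrm{tr}\big(\rho(\gamma)\rho(\gamma)^t\big)\right)^{2m}\le n^m\left(c_1\sum_{h\in E}\mathrm{tr}(\rho(h))^{\frac{2m}{|h|_F}}\right)^{2(n-1)}$$ holds.
   Context: $\overline{\mathbb Q}^r$ is the field of real algebraic numbers; $\mathbf G$ is assumed (as one may) invariant under transposition; $\mathbf G(\mathbb R)=\mathbf G\cap\mathrm{SL}(n,\mathbb R)$. On $M_{n,n}(\mathbb R)^f$ put $\|A\|^2=\sum_{i=1}^f\mathrm{tr}(A_i^tA_i)$. A tuple $A\in M_{n,n}(\mathbb R)^f$ is minimal (for $\mathbf G(\mathbb R)$) if $\|gAg^{-1}\|\ge\|A\|$ for all $g\in\mathbf G(\mathbb R)$, where $g$ acts by simultaneous conjugation on the entries of the tuple. $E=F^{2^n-1}$ is the set of elements $h\in\Gamma$ that can be written as words of length at most $2^n-1$ in the generating set $F$, and for such $h$, $|h|_F$ denotes its word length with respect to $F$, i.e. the least $r\ge1$ such that $h$ is a product of $r$ elements of $F$.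
   Formalization: The formal theorem assumes n ≥ 2; for n = 1 the group is trivial, m = 1 and the inequality reads f² ≤ 1, which fails for f ≥ 2. *)

(* Defs.v *)
From HB Require Import structures.
From mathcomp Require Import all_boot all_order all_algebra.
From mathcomp Require Import finmap.
From mathcomp Require Import boolp classical_sets reals.
From mathcomp Require Import complex.
From mathcomp Require Import mpoly.

Set Implicit Arguments.
Unset Strict Implicit.
Unset Printing Implicit Defensive.

Import Order.TTheory GRing.Theory Num.Theory.

Local Open Scope classical_set_scope.
Local Open Scope ring_scope.

Section AlgebraicSets.
Variables (K : fieldType) (n : nat).
Implicit Types (X Y Z : set 'M[K]_n) (k : set K).

(* Polynomial functions on M_n(K): the variables are the n * n entries, in the
   order given by mxvec. *)
Definition mxeval (A : 'M[K]_n) (p : {mpoly K[n * n]}) : K :=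
  p.@[fun i => mxvec A 0 i].

Definition vanishes_on X (p : {mpoly K[n * n]}) : Prop :=
  forall A, X A -> mxeval A p = 0.

Definition zariski_closed X : Prop :=
  exists S : set {mpoly K[n * n]},
    X = [set A | forall p, S p -> mxeval A p = 0].

Definition zariski_connected X : Prop :=
  forall Y Z, zariski_closed Y -> zariski_closed Z ->
    X `<=` Y `|` Z -> X `&` Y `&` Z = set0 ->
    X `<=` Y \/ X `<=` Z.

Definition has_coefs_in k (p : {mpoly K[n * n]}) : Prop :=
  forall m : 'X_{1..n * n}, k p@_m.

(* X is defined over the subfield k when its vanishing ideal is generated by
   polynomials with coefficients in k. *)
Definition defined_over k X : Prop :=
  forall p, vanishes_on X p ->
    exists s : seq ({mpoly K[n * n]} * {mpoly K[n * n]}),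
      (forall qr, qr \in s -> vanishes_on X qr.2 /\ has_coefs_in k qr.2) /\
      p = \sum_(qr <- s) qr.1 * qr.2.

End AlgebraicSets.

Section MatrixGroups.
Variables (K : fieldType) (n : nat).
Implicit Types G H : set 'M[K]_n.

Definition matrix_group H : Prop :=
  [/\ forall A, H A -> A \in unitmx,
      H 1%:M,
      forall A B, H A -> H B -> H (A *m B)
    & forall A, H A -> H (invmx A)].

Definition normal_in H G : Prop :=
  H `<=` G /\ forall g h, G g -> H h -> H (g *m h *m invmx g).

Definition derived_group H : set 'M[K]_n :=
  [set x | forall L, matrix_group L ->
     (forall a b, H a -> H b -> L (a *m b *m invmx a *m invmx b)) -> L x].

Definition solvable_group H : Prop :=
  exists d : nat, iter d derived_group H `<=` [set 1%:M].

Definition algebraic_group_in_SL G : Prop :=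
  [/\ matrix_group G, zariski_closed G & forall A, G A -> \det A = 1].

(* The radical, i.e. the largest closed connected solvable normal subgroup, is
   trivial. *)
Definition semisimple G : Prop :=
  forall H, matrix_group H -> zariski_closed H -> zariski_connected H ->
    solvable_group H -> normal_in H G -> H `<=` [set 1%:M].

Definition transpose_invariant G : Prop := forall A, G A -> G A^T.

End MatrixGroups.

Section Reals.
Variable R : realType.

Definition real_algebraic : set R[i] :=
  [set z | exists2 a : R, z = a%:C%C & algebraicOver (ratr : rat -> R) a].

Definition real_points n (G : set 'M[R[i]]_n) : set 'M[R]_n :=
  [set A | G (map_mx (real_complex R) A)].

Definition tuple_norm n (I : finType) (A : I -> 'M[R]_n) : R :=
  Num.sqrt (\sum_i \tr ((A i)^T *m A i)).

Definition minimal n (G : set 'M[R[i]]_n) (I : finType) (A : I -> 'M[R]_n) :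
    Prop :=
  forall g, real_points G g ->
    tuple_norm A <= tuple_norm (fun i => g *m A i *m invmx g).

End Reals.

Section Words.
Variable Gam : groupType.
Implicit Types F : {fset Gam}.

Definition generates F : Prop :=
  forall S : set Gam, S 1%g -> (forall x y, S x -> S y -> S (x * y)%g) ->
    (forall x, S x -> S (x^-1)%g) -> (forall x, x \in F -> S x) ->
    forall x, S x.

Fixpoint products F (r : nat) : {fset Gam} :=
  if r is r'.+1 then [fset (x * y)%g | x in F, y in products F r']%fset
  else [fset 1%g]%fset.

(* Nonempty words only: the identity belongs to the ball exactly when it is a
   product of between 1 and N elements of F. *)
Definition word_ball F (N : nat) : {fset Gam} :=
  (\bigcup_(r <- iota 1 N) products F r)%fset.

(* Least r >= 1 such that h is a product of r elements of F (and 0 if there is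
   none). *)
Definition word_length F (h : Gam) : nat :=
  if pselect (exists r, (0 < r)%N && (h \in products F r)) is left hP
  then ex_minn hP else 0%N.

End Words.

Definition representation_in (R : realType) (n : nat) (G : set 'M[R[i]]_n)
    (Gam : groupType) (rho : Gam -> 'M[R]_n) : Prop :=
  [/\ forall x, real_points G (rho x), rho 1%g = 1%:M
    & forall x y, rho (x * y)%g = rho x *m rho y].

Definition lcm_upto (N : nat) : nat := (\big[lcmn/1]_(1 <= i < N.+1) i)%N.

(* Main.v *)
(* Write N for the matrix size. Let T be the trace sum and A = (rho gam)_(gam in F),
   and measure tuples by the sum of the squared Frobenius norms.

   (1) A is conjugate in GL_N(R) to a tuple of squared norm beta = O(t^2), where
   t^(2m) = 1 + T bounds all traces of words of length k <= 2^N - 1 by t^k. By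
   compactness it is enough to see that a tuple all of whose short words are
   traceless can be conjugated arbitrarily close to 0. Dimension counting shows that
   the short words then span an algebra, on which the trace vanishes; this algebra
   is nil, hence nilpotent of index 2^N - 1 by the Nagata-Higman theorem, and an
   explicit quadratic form is contracted by the tuple. The same statement bounds T
   from below, because a matrix of determinant 1 has norm at least 1.

   (2) For Q in the symmetric space of GL_N(R), the nearest point projection to the
   totally geodesic orbit of G(R) does not increase displacements, as this space is
   CAT(0). Hence some conjugate of A under G(R), and so the minimal tuple A itself,
   has displacements at the base point at most those of the tuple found in (1). The
   displacement of g is the Euclidean norm of the logarithms of the singular values,
   and since these have sum 0, passing to operator norms costs the exponent N - 1.

   The projection is only needed up to a bounded error, so an almost nearest point
   is used. The orbit is totally geodesic because G(R) contains the real powers of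
   its positive definite elements: an exponential sum that vanishes at the natural
   numbers vanishes everywhere. *)
Require Import Defs.
From HB Require Import structures.
From mathcomp Require Import all_boot all_order all_algebra.
From mathcomp Require Import finmap.
From mathcomp Require Import boolp classical_sets reals.
From mathcomp Require Import complex.
From mathcomp Require Import sesquilinear spectral.
From mathcomp Require Import topology normedtype sequences derive realfun exp.
From mathcomp Require Import ring lra zify.

Set Implicit Arguments.
Unset Strict Implicit.
Unset Printing Implicit Defensive.

Import Order.TTheory GRing.Theory Num.Theory.
Import numFieldNormedType.Exports.

Local Open Scope ring_scope.

(** * The real spectral theorem *)

Definition orthogonal n (R : realType) (U : 'M[R]_n) : Prop := U *m U^T = 1%:M.

Lemma orthogonalC n (R : realType) (U : 'M[R]_n) : orthogonal U -> U^T *m U = 1%:M.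
Proof. exact: mulmx1C. Qed.

Lemma orthogonalT n (R : realType) (U : 'M[R]_n) : orthogonal U -> orthogonal U^T.
Proof. by move=> UU; rewrite /orthogonal trmxK; exact: mulmx1C. Qed.

Lemma orthogonalM n (R : realType) (U V : 'M[R]_n) :
  orthogonal U -> orthogonal V -> orthogonal (U *m V).
Proof. by move=> UU VV; rewrite /orthogonal trmx_mul mulmxA -(mulmxA U) VV mulmx1. Qed.

Lemma rV_sqr_gt0 n (R : realType) (v : 'rV[R]_n) : v != 0 -> 0 < (v *m v^T) 0 0.
Proof.
move=> v0; rewrite mxE lt_def; apply/andP; split; last first.
  by apply: sumr_ge0 => i _; rewrite mxE -expr2 sqr_ge0.
apply: contra v0 => /eqP v0; apply/eqP/rowP => i; rewrite mxE.
apply/eqP; rewrite -sqrf_eq0; apply/eqP.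
have := psumr_eq0P _ v0 => /(_ _ i isT); rewrite mxE -expr2; apply=> j _.
by rewrite mxE -expr2 sqr_ge0.
Qed.

(* The Householder reflection exchanging the unit vectors [v] and [e_0]. *)
Lemma householder n (R : realType) (v : 'rV[R]_n.+1) :
  v *m v^T = 1%:M -> exists2 H : 'M[R]_n.+1, orthogonal H & row 0 H = v.
Proof.
move=> vv; pose e := delta_mx 0 0 : 'rV[R]_n.+1.
have [->|ve] := eqVneq v e.
  exists 1%:M; first by rewrite /orthogonal trmx1 mulmx1.
  by apply/rowP => j; rewrite !mxE eqxx /= eq_sym.
pose u := v - e; have u0 : u != 0 by rewrite subr_eq0.
set c := (u *m u^T) 0 0; have c0 : 0 < c by exact: rV_sqr_gt0.
have uu : u *m u^T = c%:M by rewrite [LHS]mx11_scalar.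
have ee : e *m e^T = 1%:M.
  rewrite /e trmx_delta mul_delta_mx; apply/matrixP => i j.
  by rewrite !ord1 !mxE.
have evC : v *m e^T = e *m v^T by apply/matrixP=> i j; rewrite !ord1 !mxE; apply: eq_bigr => k _; rewrite !mxE mulrC.
have eu : e *m u^T = (- (c / 2))%:M.
  have : u *m u^T = - (2 : R) *: (e *m u^T).
    rewrite /u [(v - e)^T]linearB /= mulmxBl !mulmxBr vv ee evC.
    apply/matrixP=> i j; rewrite !ord1 !mxE; ring.
  rewrite uu => /(congr1 (fun M => - (1/2 : R) *: M)).
  rewrite scalerA (_ : - (1/2) * - 2 = 1 :> R) ?scale1r; last by field.
  move=> <-; apply/matrixP=> i j; rewrite !ord1 !mxE eqxx /=; by field.
exists (1%:M - (2 / c) *: (u^T *m u)).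
  have NN : (u^T *m u) *m (u^T *m u) = c *: (u^T *m u).
    by rewrite -mulmxA [u *m (_ *m _)]mulmxA uu mul_scalar_mx -scalemxAr.
  have NT : (u^T *m u)^T = u^T *m u by rewrite trmx_mul trmxK.
  rewrite /orthogonal; move: (u^T *m u) NN NT => N NN NT.
  rewrite [(_ - _)^T]linearB /= [(_ *: _)^T]linearZ /= trmx1 NT mulmxBl mulmxBr mul1mx mulmxBr !mulmx1.
  rewrite mul1mx -scalemxAl -scalemxAr NN !scalerA.
  rewrite (_ : 2 / c * (2 / c) * c = 2 / c + 2 / c); last first.
    by field; rewrite gt_eqF.
  by rewrite scalerDl opprB addrK addrNK.
rewrite rowE -/e mulmxBr mulmx1 -scalemxAr mulmxA eu mul_scalar_mx scalerA.
rewrite (_ : 2 / c * - (c / 2) = -1); last by field; rewrite gt_eqF.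
by rewrite scaleN1r opprK /u addrC subrK.
Qed.

(** Over the complex numbers [S] is hermitian, so its eigenvalues are real; a real root of the
    characteristic polynomial has an eigenvector with real entries. *)
Lemma symmetric_eigenvector n (R : realType) (S : 'M[R]_n.+1) :
  S^T = S -> exists a, exists2 v : 'rV_n.+1, v *m v^T = 1%:M & v *m S = a *: v.
Proof.
move=> Ssym; pose A := map_mx (real_complex R) S.
have Ah : A \is hermsymmx.
  apply/is_hermitianmxP; rewrite expr0 scale1r; apply/matrixP => i j.
  by rewrite !mxE -{1}Ssym mxE; apply/esym/CrealP; rewrite complex_real.
have /mxOverP/(_ 0 0) D0 := hermitian_spectral_diag_real Ah.
have /orthomx_spectralP AE := hermitian_normalmx Ah.
have Pu := spectral_unit A.
set P := spectralmx A in AE Pu; set D := spectral_diag A in AE D0.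
have [a Da] : exists a : R, D 0 0 = a%:C%C.
  by move: D0 => /complex_realP.
have eA : eigenvalue A (a%:C%C).
  apply/eigenvalueP; exists (row 0 P).
    rewrite -row_mul {1}AE !mulmxA mulmxV // mul1mx row_mul row_diag_mx Da.
    by rewrite -scalemxAl -rowE.
  apply: contraTneq Pu => P0; rewrite unitmxE (expand_det_row _ 0) big1 ?unitr0 //.
  by move=> j _; move/rowP/(_ j): P0; rewrite !mxE => ->; rewrite mul0r.
have /eigenvalueP[v vS v0] : eigenvalue S a.
  by move: eA; rewrite !eigenvalue_root_char -map_char_poly fmorph_root.
have vv := rV_sqr_gt0 v0; set c := (v *m v^T) 0 0 in vv.
exists a; exists ((Num.sqrt c)^-1 *: v).
  rewrite linearZ /= -scalemxAl -scalemxAr scalerA -invfM -expr2 sqr_sqrtr ?ltW//.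
  rewrite [v *m _]mx11_scalar -/c scale_scalar_mx mulVf // gt_eqF //.
by rewrite -scalemxAl vS !scalerA mulrC.
Qed.

(** A Householder reflection makes a unit eigenvector the first basis vector. This clears the first
    row off the diagonal, hence by symmetry the first column, and induction treats the remaining
    block. *)
Lemma spectral_symmetric n (R : realType) (S : 'M[R]_n) :
  S^T = S -> exists2 U, orthogonal U & exists d, S = U *m diag_mx d *m U^T.
Proof.
elim: n S => [|n IH] S Ssym.
  exists 1%:M; first by rewrite /orthogonal trmx1 mulmx1.
  by exists 0; apply/matrixP; case.
have [a [v vv vS]] := symmetric_eigenvector Ssym.
have [H HH Hv] := householder vv.
have [T TE] : exists T : 'M_(1 + n), T = H *m S *m H^T by eexists.
have Tsym : T^T = T by rewrite TE !trmx_mul trmxK Ssym mulmxA.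
have T0 : row 0 T = a *: delta_mx 0 0.
  by rewrite TE -mulmxA row_mul Hv mulmxA vS -scalemxAl -Hv -row_mul HH row1.
have Tb : T = block_mx a%:M 0 0 (drsubmx T).
  have T0j j : T 0 j = a * (0 == j)%:R.
    by move/rowP/(_ j): T0; rewrite !mxE eqxx /= eq_sym => ->.
  rewrite -[LHS]submxK; congr block_mx.
  - apply/matrixP => i j; rewrite !ord1 !mxE lshift0 T0j eqxx mulr1 //.
  - apply/matrixP => i j; rewrite !ord1 !mxE lshift0 T0j /= mulr0 //.
  - by rewrite -[T]Tsym; apply/matrixP => i j; rewrite !ord1 !mxE lshift0 T0j mulr0.
have Ssym' : (drsubmx T)^T = drsubmx T by rewrite trmx_drsub Tsym.
have [V VV [d dE]] := IH _ Ssym'.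
pose W : 'M_(1 + n) := block_mx 1%:M 0 0 V.
have WW : orthogonal W.
  rewrite /orthogonal /W tr_block_mx mulmx_block !trmx0 !mulmx0 !mul0mx trmx1 mulmx1.
  by rewrite !addr0 add0r VV -scalar_mx_block.
exists (H^T *m W).
  by apply: orthogonalM WW; exact: orthogonalT.
exists (row_mx a%:M d : 'rV_(1 + n)).
have TW : T = W *m diag_mx (row_mx a%:M d : 'rV_(1 + n)) *m W^T.
  rewrite Tb dE /W tr_block_mx diag_mx_row !mulmx_block.
  rewrite !trmx0 !mulmx0 !mul0mx trmx1 !mul1mx !mulmx1 !addr0 !add0r mul0mx.
  by congr block_mx; apply/matrixP=> i j; rewrite !ord1 !mxE eqxx.
rewrite trmx_mul trmxK !mulmxA -(mulmxA H^T) -(mulmxA H^T) -TW TE.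
by rewrite !mulmxA orthogonalC // mul1mx -mulmxA orthogonalC // mulmx1.
Qed.

(** * Quadratic bounds for the hyperbolic cosine *)

Lemma sinh_lower (R : realType) (v : R) : 0 <= v -> 2 * v <= expR v - expR (- v).
Proof.
move=> v0; pose h (x : R) := expR x - expR (- x) - 2 * x.
have dh (x : R) : is_derive x (1 : R) h (expR x + expR (- x) - 2).
  have dN : is_derive x (1 : R) (fun y : R => expR (- y)) (- expR (- x)).
    have := @is_derive1_comp R expR -%R x _ _ (is_derive_expR (- x)) (is_deriveNid _ _).
    by rewrite mulrN1.
  apply: is_derive_eq; by rewrite /GRing.scale /=; ring.
have : h 0 <= h v.
  apply: (@ger0_derive1_le_cc _ h 0 v) => //.
  - move=> x _; rewrite derive1E derive_val.
    have := expR_gt0 x; rewrite expRN => ex.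
    have : 0 <= (expR x - 1) ^+ 2 / expR x by rewrite divr_ge0 ?sqr_ge0// ltW.
    rewrite (_ : (_ - 1) ^+ 2 / _ = expR x + (expR x)^-1 - 2) //; field.
    by rewrite gt_eqF.
  - by apply: derivable_within_continuous => x _.
  - by rewrite in_itv /= lexx.
  - by rewrite in_itv /= lexx v0.
by rewrite /h oppr0 expR0 mulr0 !subr0 subrr; lra.
Qed.

(** For [u >= 0] the right side is the square of [exp (u / 2) - exp (- (u / 2))], which is at least
    [u]. *)
Lemma cosh_lower (R : realType) (u : R) : u ^+ 2 <= expR u + expR (- u) - 2.
Proof.
wlog u0 : u / 0 <= u.
  move=> W; have [/W//|/ltW u0] := leP 0 u.
  by have := W (- u); rewrite sqrrN opprK oppr_ge0 => /(_ u0); rewrite [expR (-u) + _]addrC.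
have -> : expR u + expR (- u) - 2 = (expR (u / 2) - expR (- (u / 2))) ^+ 2.
  have -> : u = u / 2 + u / 2 by field.
  rewrite [in - (_ + _)]opprD !expRD.
  rewrite (_ : (u / 2 + u / 2) / 2 = u / 2); last by field.
  have := expRxMexpNx_1 (u / 2); move: (expR (u/2)) (expR (-(u/2))) => a b ab.
  rewrite sqrrB -!expr2 ab; ring.
have : 0 <= u / 2 by rewrite divr_ge0.
move/sinh_lower; rewrite (_ : 2 * (u / 2) = u); last by field.
move=> h.
by rewrite ler_sqr ?nnegrE //; exact: le_trans h.
Qed.

(* From [exp v <= 1 / (1 - v)] for [v < 1]. *)
Lemma cosh_upper (R : realType) (u : R) : `|u| < 2 ->
  expR u + expR (- u) - 2 <= u ^+ 2 / (1 - `|u| / 2) ^+ 2.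
Proof.
wlog u0 : u / 0 <= u.
  move=> W; have [/W//|/ltW u0] := leP 0 u.
  by have := W (- u); rewrite sqrrN opprK oppr_ge0 normrN => /(_ u0); rewrite [expR (-u) + _]addrC.
rewrite ger0_norm // => u2.
have -> : expR u + expR (- u) - 2 = (expR (u / 2) - expR (- (u / 2))) ^+ 2.
  have -> : u = u / 2 + u / 2 by field.
  rewrite [in - (_ + _)]opprD !expRD.
  rewrite (_ : (u / 2 + u / 2) / 2 = u / 2); last by field.
  have := expRxMexpNx_1 (u / 2); move: (expR (u/2)) (expR (-(u/2))) => a b ab.
  rewrite sqrrB -!expr2 ab; ring.
have -> : u ^+ 2 / (1 - u / 2) ^+ 2 = (u / (1 - u / 2)) ^+ 2 by rewrite expr_div_n.
have v0 : 0 <= u / 2 by lra.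
have v1 : 0 < 1 - u / 2 by lra.
have h0 := sinh_lower v0.
have h1 := expR_ge1Dx (- (u / 2)).
have e0 := expR_gt0 (- (u / 2)).
have h2 : expR (u / 2) <= (1 - u / 2)^-1.
  by rewrite -[u / 2 in leLHS]opprK expRN lef_pV2 ?posrE.
have s0 : 0 <= expR (u / 2) - expR (- (u / 2)) by rewrite (le_trans _ h0) // mulr_ge0.
have t0 : 0 <= u / (1 - u / 2) by rewrite divr_ge0 // ltW.
rewrite ler_sqr ?nnegrE //.
apply: (le_trans (lerB h2 h1)).
rewrite -subr_ge0.
have -> : u / (1 - u / 2) - ((1 - u / 2)^-1 - (1 + - (u / 2))) = (u / 2) ^+ 2 / (1 - u / 2).
  by field; apply/lt0r_neq0; rewrite subr_gt0.
by rewrite divr_ge0 ?sqr_ge0 ?ltW.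
Qed.

(** * Logarithms of positive definite matrices *)

Definition expmx_diag (R : realType) n (x : 'rV[R]_n) : 'M[R]_n :=
  diag_mx (map_mx (@expR R) x).

Definition sqnorm (R : realType) n (x : 'rV[R]_n) : R := \sum_i x 0 i ^+ 2.

Definition frob (R : realType) n (A : 'M[R]_n) : R := \tr (A *m A^T).

Section DiagonalExponential.
Variables (R : realType) (n : nat).
Implicit Types (x y : 'rV[R]_n) (U V A B : 'M[R]_n).

Lemma expmx_diag0 : expmx_diag (0 : 'rV[R]_n) = 1%:M.
Proof. by apply/matrixP => i j; rewrite !mxE expR0. Qed.

Lemma expmx_diagD x y : expmx_diag (x + y) = expmx_diag x *m expmx_diag y.
Proof. by rewrite mulmx_diag; congr diag_mx; apply/rowP=> i; rewrite !mxE expRD. Qed.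

Lemma expmx_diagT x : (expmx_diag x)^T = expmx_diag x.
Proof. exact: tr_diag_mx. Qed.

Lemma expmx_diagNV x : expmx_diag (- x) *m expmx_diag x = 1%:M.
Proof. by rewrite -expmx_diagD addNr expmx_diag0. Qed.

Lemma expmx_diagVN x : expmx_diag x *m expmx_diag (- x) = 1%:M.
Proof. by rewrite -expmx_diagD subrr expmx_diag0. Qed.

Lemma expmx_diag_unit x : expmx_diag x \in unitmx.
Proof. by case: (mulmx1_unit (expmx_diagVN x)). Qed.

Lemma orthogonal_unit U : orthogonal U -> U \in unitmx.
Proof. by case/mulmx1_unit. Qed.

Lemma sqnorm_ge0 x : 0 <= sqnorm x.
Proof. by apply: sumr_ge0 => i _; exact: sqr_ge0. Qed.

Lemma sqnormN x : sqnorm (- x) = sqnorm x.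
Proof. by apply: eq_bigr => i _; rewrite mxE sqrrN. Qed.

Lemma frobE A : frob A = \sum_i \sum_j A i j ^+ 2.
Proof.
by apply: eq_bigr => i _; rewrite mxE; apply: eq_bigr => j _; rewrite mxE expr2.
Qed.

Lemma frob_ge0 A : 0 <= frob A.
Proof. by rewrite frobE; apply: sumr_ge0 => i _; apply: sumr_ge0 => j _; exact: sqr_ge0. Qed.

Lemma frob_conj U A : orthogonal U -> frob (U *m A *m U^T) = frob A.
Proof.
move=> UU; rewrite /frob !trmx_mul trmxK !mulmxA -(mulmxA (U *m A)) orthogonalC //.
by rewrite mulmx1 -mulmxA mxtrace_mulC mulmxA -(mulmxA A^T) orthogonalC // mulmx1 mxtrace_mulC.
Qed.

Lemma frob_diag x : frob (diag_mx x) = sqnorm x.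
Proof.
rewrite /frob tr_diag_mx mulmx_diag mxtrace_diag.
by apply: eq_bigr => i _; rewrite mxE expr2.
Qed.

Lemma mxtrace_conj_diag U V x y :
  \tr (U *m diag_mx x *m U^T *m (V *m diag_mx y *m V^T)) =
  \sum_i \sum_j (U^T *m V) i j ^+ 2 * (x 0 i * y 0 j).
Proof.
pose W := U^T *m V.
have -> : \tr (U *m diag_mx x *m U^T *m (V *m diag_mx y *m V^T)) =
          \tr (diag_mx x *m W *m (diag_mx y *m W^T)).
  by rewrite -!mulmxA mxtrace_mulC /W trmx_mul trmxK !mulmxA.
apply: eq_bigr => i _; rewrite mxE; apply: eq_bigr => j _.
rewrite mul_diag_mx  mul_diag_mx !mxE; ring.
Qed.

(** Taking [y = 1] in the previous formula shows that the squared entries of the orthogonal matrix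
    [U^T V] have row sums 1; column sums follow by exchanging [U] and [V]. *)
Lemma mxtrace_conj_diag1 U V x : orthogonal U -> orthogonal V ->
  \sum_i \sum_j (U^T *m V) i j ^+ 2 * x 0 i = \sum_i x 0 i.
Proof.
move=> UU VV; have := mxtrace_conj_diag U V x (const_mx 1).
rewrite diag_const_mx mulmx1 VV mulmx1 mxtrace_mulC mulmxA orthogonalC // mul1mx.
rewrite mxtrace_diag => ->; apply: eq_bigr => i _; apply: eq_bigr => j _.
by congr (_ * _); rewrite mxE mulr1.
Qed.

Lemma mxtrace_conj_diag1r U V x : orthogonal U -> orthogonal V ->
  \sum_i \sum_j (U^T *m V) i j ^+ 2 * x 0 j = \sum_i x 0 i.
Proof.
move=> UU VV; rewrite exchange_big -(mxtrace_conj_diag1 x VV UU).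
apply: eq_bigr => i _; apply: eq_bigr => j _; congr (_ ^+ 2 * _).
have -> : V^T *m U = (U^T *m V)^T by rewrite trmx_mul trmxK.
by rewrite [RHS]mxE.
Qed.

(* In the eigenbases of the two matrices, with [W] the transition matrix, the
   left side is [\sum_(i, j) W_ij^2 (x_i - y_j)^2] and the right side is
   [\sum_(i, j) W_ij^2 (2 cosh (x_i - y_j) - 2)]. *)
Lemma frob_log_le U V x y : orthogonal U -> orthogonal V ->
  frob (U *m diag_mx x *m U^T - V *m diag_mx y *m V^T) <=
  \tr (U *m expmx_diag (- x) *m U^T *m (V *m expmx_diag y *m V^T)) +
  \tr (U *m expmx_diag x *m U^T *m (V *m expmx_diag (- y) *m V^T)) - 2 * n%:R.
Proof.
move=> UU VV.
have symD (W : 'M[R]_n) (z : 'rV[R]_n) : (W *m diag_mx z *m W^T)^T = W *m diag_mx z *m W^T.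
  by rewrite !trmx_mul trmxK tr_diag_mx mulmxA.
have -> : frob (U *m diag_mx x *m U^T - V *m diag_mx y *m V^T) =
    frob (U *m diag_mx x *m U^T) + frob (V *m diag_mx y *m V^T)
    - 2 * \tr (U *m diag_mx x *m U^T *m (V *m diag_mx y *m V^T)).
  rewrite /frob [(_ - _)^T]linearB /= !symD.
  move: (U *m _ *m _) (V *m _ *m _) => X Y.
  by rewrite mulmxBl !mulmxBr !mxtraceD ![\tr (- _)]linearN /= mxtraceD linearN /= (mxtrace_mulC Y X); ring.
rewrite !frob_conj // !frob_diag !mxtrace_conj_diag.
have -> : sqnorm x = \sum_i \sum_j (U^T *m V) i j ^+ 2 * x 0 i ^+ 2.
  transitivity (\sum_i (\row_k x 0 k ^+ 2) 0 i); first by apply: eq_bigr => i _; rewrite mxE.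
  rewrite -(mxtrace_conj_diag1 _ UU VV).
  by do 2![apply: eq_bigr => ? _]; congr (_ * _); rewrite mxE.
have -> : sqnorm y = \sum_i \sum_j (U^T *m V) i j ^+ 2 * y 0 j ^+ 2.
  transitivity (\sum_i (\row_k y 0 k ^+ 2) 0 i); first by apply: eq_bigr => i _; rewrite mxE.
  rewrite -(mxtrace_conj_diag1r _ UU VV).
  by do 2![apply: eq_bigr => ? _]; congr (_ * _); rewrite mxE.
have -> : n%:R = \sum_i \sum_j (U^T *m V) i j ^+ 2.
  transitivity (\sum_i (const_mx 1 : 'rV[R]_n) 0 i).
    by under eq_bigr do rewrite mxE; rewrite sumr_const card_ord.
  rewrite -(mxtrace_conj_diag1 _ UU VV).
  by do 2![apply: eq_bigr => ? _]; rewrite [const_mx _ _ _]mxE mulr1.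
move: (U^T *m V) => W.
rewrite !mulr_sumr -!sumrN -!big_split /=; apply: ler_sum => i _.
rewrite !mulr_sumr -!sumrN -!big_split /=; apply: ler_sum => j _.
rewrite !mxE; have := cosh_lower (x 0 i - y 0 j).
rewrite opprB !expRD; have := sqr_ge0 (W i j).
move: (W i j ^+ 2) (expR _) (expR _) (expR _) (expR _) => w a b c d W0 h.
have wh := mulr_ge0 W0 (etrans (subr_ge0 _ _) h).
rewrite -subr_ge0 (_ : _ - _ = w * (d * c + b * a - 2 - (x 0 i - y 0 j) ^+ 2)) //; ring.
Qed.

End DiagonalExponential.

(* [P] and [Q] are simultaneously diagonalized by a congruence, and [x] lists
   the logarithms of the eigenvalues of [P^-1 Q]; [sqnorm x] is the square of
   the distance from [P] to [Q] in the symmetric space of [GL_n(R)]. *)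
Definition relative_log (R : realType) n (P Q : 'M[R]_n) (x : 'rV[R]_n) : Prop :=
  exists2 g, g \in unitmx & P = g *m g^T /\ Q = g *m expmx_diag x *m g^T.

Section RelativeLog.
Variables (R : realType) (n : nat).
Implicit Types (x y z a b : 'rV[R]_n) (U V A B P Q g h : 'M[R]_n).

Lemma posdef_spectral A : A^T = A ->
  (forall v : 'rV[R]_n, v != 0 -> 0 < (v *m A *m v^T) 0 0) ->
  exists2 U, orthogonal U & exists x, A = U *m expmx_diag x *m U^T.
Proof.
move=> AT Apos; have [U UU [d AE]] := spectral_symmetric AT.
exists U => //; exists (map_mx (@ln R) d).
have d0 i : 0 < d 0 i.
  pose e := delta_mx 0 i : 'rV[R]_n.
  have ee : e != 0 by apply/negP => /eqP /rowP /(_ i) /eqP; rewrite !mxE !eqxx oner_eq0.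
  have := Apos (e *m U^T).
  have -> : e *m U^T *m A *m (e *m U^T)^T = e *m diag_mx d *m e^T.
    rewrite AE trmx_mul trmxK !mulmxA -(mulmxA e) orthogonalC // mulmx1.
    by rewrite -(mulmxA _ U^T) orthogonalC // mulmx1.
  have -> : e *m diag_mx d *m e^T = (d 0 i)%:M.
    rewrite /e -rowE row_diag_mx -scalemxAl trmx_delta mul_delta_mx.
    by apply/matrixP => j k; rewrite !ord1 !mxE eqxx mulr1.
  rewrite mxE eqxx; apply.
  apply: contra ee => /eqP /(congr1 (mulmx^~ U)).
  by rewrite -mulmxA orthogonalC // mulmx1 mul0mx => /eqP.
rewrite AE; congr (_ *m _ *m _); rewrite /expmx_diag; congr diag_mx.
by apply/rowP => i; rewrite !mxE lnK // posrE.
Qed.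

Lemma gram_spectral g : g \in unitmx ->
  exists2 U, orthogonal U & exists x, g *m g^T = U *m expmx_diag x *m U^T.
Proof.
move=> gu; apply: posdef_spectral => [|v v0]; first by rewrite trmx_mul trmxK.
rewrite mulmxA -mulmxA -trmx_mul; apply: rV_sqr_gt0.
by apply: contra v0 => /eqP /(congr1 (mulmx^~ (invmx g))); rewrite mulmxK // mul0mx => ->.
Qed.

Lemma expmx_diag_half x : expmx_diag x = expmx_diag (2^-1 *: x) *m (expmx_diag (2^-1 *: x))^T.
Proof.
rewrite expmx_diagT -expmx_diagD -scalerDl; congr expmx_diag.
by rewrite -[LHS]scale1r; congr (_ *: _); field.
Qed.

Lemma gram_expmx_diag g x : g \in unitmx ->
  exists2 h, h \in unitmx & g *m expmx_diag x *m g^T = h *m h^T.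
Proof.
move=> gu; exists (g *m expmx_diag (2^-1 *: x)).
  by rewrite unitmx_mul gu expmx_diag_unit.
by rewrite trmx_mul !mulmxA -[_ *m _ *m (expmx_diag _)^T]mulmxA -expmx_diag_half.
Qed.

Lemma conj_expmx_diagN U g x a : orthogonal U -> g \in unitmx ->
  U *m expmx_diag x *m U^T = g *m expmx_diag a *m g^T ->
  U *m expmx_diag (- x) *m U^T = (invmx g)^T *m expmx_diag (- a) *m invmx g.
Proof.
move=> UU gu UE.
have h1 : U *m expmx_diag (- x) *m U^T *m (U *m expmx_diag x *m U^T) = 1%:M.
  rewrite !mulmxA -(mulmxA _ U^T U) orthogonalC // mulmx1.
  by rewrite -(mulmxA U) expmx_diagNV mulmx1.
have h2 : (g *m expmx_diag a *m g^T) *m ((invmx g)^T *m expmx_diag (- a) *m invmx g) = 1%:M.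
  rewrite !mulmxA -(mulmxA _ g^T) -trmx_mul mulVmx // trmx1 mulmx1.
  by rewrite -(mulmxA g) expmx_diagVN mulmx1 mulmxV.
by rewrite -[LHS]mulmx1 -h2 -UE mulmxA h1 mul1mx.
Qed.

(** For the two positive definite matrices [P] and [Q], the bound of [frob_log_le] is
    [tr (P^-1 Q) + tr (P Q^-1) - 2 n]. It is invariant under congruence, so it can be computed in
    the frame [g]. *)
Lemma frob_log_step U V g x y a b : orthogonal U -> orthogonal V -> g \in unitmx ->
  U *m expmx_diag x *m U^T = g *m expmx_diag a *m g^T ->
  V *m expmx_diag y *m V^T = g *m expmx_diag b *m g^T ->
  frob (U *m diag_mx x *m U^T - V *m diag_mx y *m V^T) <=
  \sum_i (expR (b 0 i - a 0 i) + expR (- (b 0 i - a 0 i)) - 2).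
Proof.
move=> UU VV gu UE VE; apply: (le_trans (frob_log_le _ _ UU VV)).
rewrite (conj_expmx_diagN UU gu UE) (conj_expmx_diagN VV gu VE) UE VE.
have gtr c d : \tr ((invmx g)^T *m expmx_diag c *m invmx g *m (g *m expmx_diag d *m g^T)) =
    \sum_i expR (d 0 i + c 0 i).
  rewrite mxtrace_mulC !mulmxA -(mulmxA _ g^T) -trmx_mul mulVmx // trmx1 mulmx1.
  rewrite -!mulmxA mxtrace_mulC !mulmxA -(mulmxA _ (invmx g)) mulVmx // mulmx1.
  by rewrite -expmx_diagD mxtrace_diag; apply: eq_bigr => i _; rewrite !mxE.
rewrite gtr mxtrace_mulC gtr.
have -> : 2 * n%:R = \sum_(i < n) (2 : R) by rewrite sumr_const card_ord mulr_natr.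
rewrite -sumrN -!big_split /= le_eqVlt; apply/orP; left; apply/eqP.
by apply: eq_bigr => i _; rewrite !mxE opprB.
Qed.

(** A triangle inequality without square roots: the weight [t = m] turns bounds [m^2 S] and [S] for
    the summands into [(m + 1)^2 S] for the sum. *)
Lemma frobD_le (t : R) A B : 0 < t ->
  frob (A + B) <= (1 + t^-1) * frob A + (1 + t) * frob B.
Proof.
move=> t0; rewrite !frobE !mulr_sumr -big_split /=; apply: ler_sum => i _.
rewrite !mulr_sumr -big_split /=; apply: ler_sum => j _; rewrite mxE.
rewrite -subr_ge0; set p := A i j; set q := B i j.
have -> : (1 + t^-1) * p ^+ 2 + (1 + t) * q ^+ 2 - (p + q) ^+ 2 = (p - t * q) ^+ 2 / t.
  by field; rewrite gt_eqF.
by rewrite divr_ge0 ?sqr_ge0 // ltW.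
Qed.

(* Subdivision of the geodesic from [g g^T] to [g (exp z) g^T] into [N + 1] steps. *)
Lemma frob_log_subdivision (N m : nat) U V g x y z :
  orthogonal U -> orthogonal V -> g \in unitmx ->
  U *m expmx_diag x *m U^T = g *m g^T ->
  V *m expmx_diag y *m V^T = g *m expmx_diag ((m.+1%:R / N.+1%:R) *: z) *m g^T ->
  frob (U *m diag_mx x *m U^T - V *m diag_mx y *m V^T) <=
  m.+1%:R ^+ 2 * \sum_i (expR (z 0 i / N.+1%:R) + expR (- (z 0 i / N.+1%:R)) - 2).
Proof.
move=> UU VV gu UE; elim: m V y VV => [|m IH] V y VV VE.
  rewrite expr1n mul1r.
  have UE' : U *m expmx_diag x *m U^T = g *m expmx_diag 0 *m g^T by rewrite expmx_diag0 mulmx1.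
  apply: (le_trans (frob_log_step UU VV gu UE' VE)).
  rewrite le_eqVlt; apply/orP; left; apply/eqP; apply: eq_bigr => i _.
  by rewrite !mxE subr0 mul1r (mulrC _^-1).
have [h hu hE] := gram_expmx_diag ((m.+1%:R / N.+1%:R) *: z) gu.
have [W WW [w wE]] := gram_spectral hu.
have WE := etrans (esym wE) (esym hE).
have m0 : 0 < m.+1%:R :> R by rewrite ltr0n.
have -> : U *m diag_mx x *m U^T - V *m diag_mx y *m V^T =
  (U *m diag_mx x *m U^T - W *m diag_mx w *m W^T) + (W *m diag_mx w *m W^T - V *m diag_mx y *m V^T).
  by rewrite addrA subrK.
apply: (le_trans (frobD_le _ _ m0)).
have h1 := IH _ _ WW WE; have h2 := frob_log_step WW VV gu WE VE.
have c1 : 0 <= 1 + m.+1%:R^-1 :> R by rewrite addr_ge0 // invr_ge0 ltW.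
have c2 : 0 <= 1 + m.+1%:R :> R by rewrite addr_ge0 // ltW.
apply: (le_trans (lerD (ler_wpM2l c1 h1) (ler_wpM2l c2 h2))).
have -> : \sum_i (expR (((m.+2%:R / N.+1%:R) *: z) 0 i - ((m.+1%:R / N.+1%:R) *: z) 0 i) +
  expR (- (((m.+2%:R / N.+1%:R) *: z) 0 i - ((m.+1%:R / N.+1%:R) *: z) 0 i)) - 2) =
  \sum_i (expR (z 0 i / N.+1%:R) + expR (- (z 0 i / N.+1%:R)) - 2).
  apply: eq_bigr => i _; rewrite !mxE.
  have -> : m.+2%:R / N.+1%:R * z 0 i - m.+1%:R / N.+1%:R * z 0 i = z 0 i / N.+1%:R.
    by rewrite -[m.+2]addn1 natrD; ring.
  by [].
move: (\sum_i _) => S; rewrite -[m.+2]addn1 natrD.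
move: m.+1%:R m0 => M M0; rewrite le_eqVlt; apply/orP; left; apply/eqP.
by field; rewrite gt_eqF.
Qed.

(* The exponential map increases distances. *)
Lemma frob_log_le_sqnorm U V g x y z :
  orthogonal U -> orthogonal V -> g \in unitmx ->
  U *m expmx_diag x *m U^T = g *m g^T ->
  V *m expmx_diag y *m V^T = g *m expmx_diag z *m g^T ->
  frob (U *m diag_mx x *m U^T - V *m diag_mx y *m V^T) <= sqnorm z.
Proof.
move=> UU VV gu UE VE; set F := frob _.
(* For a fine subdivision every [z_i / (N + 1)] is below [e], and then [cosh_upper] costs at most
   the factor [(1 - e)^-2]. *)
have Fe (e : R) : 0 < e -> e < 1 -> (1 - e) ^+ 2 * F <= sqnorm z.
  move=> e0 e1; pose Z := \sum_i `|z 0 i|.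
  have [N ZN] : exists N, Z / e < N.+1%:R.
    exists (Num.truncn (Z / e)); rewrite -[_.+1%:R]ger0_norm //.
    by have := truncnS_gt (Z / e); rewrite ger0_norm.
  have N0 : 0 < N.+1%:R :> R by rewrite ltr0n.
  have VE' : V *m expmx_diag y *m V^T = g *m expmx_diag ((N.+1%:R / N.+1%:R) *: z) *m g^T.
    by rewrite divff ?gt_eqF // scale1r.
  have := frob_log_subdivision UU VV gu UE VE'; rewrite -/F => FN.
  have e10 : 0 < 1 - e by rewrite subr_gt0.
  rewrite mulrC -ler_pdivlMr ?exprn_gt0 //; apply: (le_trans FN).
  rewrite mulr_sumr /sqnorm mulr_suml; apply: ler_sum => i _.
  set u := z 0 i / N.+1%:R.
  have ue : `|u| < e.
    rewrite normrM [X in _ * X]ger0_norm ?invr_ge0 ?ltW // ltr_pdivrMr //.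
    rewrite -ltr_pdivrMl // mulrC; apply: le_lt_trans ZN.
    by rewrite ler_pM2r ?invr_gt0 // /Z (bigD1 i) //= lerDl; apply: sumr_ge0.
  have u2 : `|u| < 2 by lra.
  have e2 : 0 < 1 - `|u| / 2 by lra.
  apply: (le_trans (ler_wpM2l _ (cosh_upper u2))); first exact: sqr_ge0.
  have uN : N.+1%:R * u = z 0 i by rewrite mulrC divfK ?gt_eqF.
  rewrite mulrA -exprMn uN.
  rewrite ler_wpM2l ?sqr_ge0 // lef_pV2 ?posrE ?exprn_gt0 //.
  rewrite ler_sqr ?nnegrE ?ltW //; rewrite -/u; have := normr_ge0 u; lra.
clearbody F; rewrite leNgt; apply/negP => zF.
have z0 := sqnorm_ge0 z; have F0 : 0 < F by apply: le_lt_trans zF.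
(* With this [e], [(1 - e)^2 F] is at least the mean of [F] and [sqnorm z], hence above
   [sqnorm z]. *)
pose e := (F - sqnorm z) / (4 * F).
have e0 : 0 < e by rewrite divr_gt0 ?subr_gt0 ?mulr_gt0.
have e1 : e < 1 by rewrite ltr_pdivrMr ?mulr_gt0 // mul1r; lra.
have eF : e * F = (F - sqnorm z) / 4 by rewrite /e; field; apply/lt0r_neq0.
have eeF : 0 <= e ^+ 2 * F by rewrite mulr_ge0 ?sqr_ge0 // ltW.
have := Fe _ e0 e1.
have -> : (1 - e) ^+ 2 * F = F - 2 * (e * F) + e ^+ 2 * F by ring.
by rewrite eF => h; clear -h eeF zF; lra.
Qed.

End RelativeLog.

(** * The symmetric space of GL_n(R) *)

Section SymmetricSpace.
Variables (R : realType) (n : nat).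
Implicit Types (x y z : 'rV[R]_n) (A B P Q S M g h : 'M[R]_n).

Lemma relative_log_conj h P Q x : h \in unitmx -> relative_log P Q x ->
  relative_log (h *m P *m h^T) (h *m Q *m h^T) x.
Proof.
move=> hu [g gu [-> ->]]; exists (h *m g); first by rewrite unitmx_mul hu.
by rewrite !trmx_mul !mulmxA.
Qed.

Lemma relative_log_sym P Q x : relative_log P Q x -> relative_log Q P (- x).
Proof.
move=> [g gu [-> ->]]; exists (g *m expmx_diag (2^-1 *: x)).
  by rewrite unitmx_mul gu expmx_diag_unit.
rewrite trmx_mul !mulmxA -[_ *m _ *m (expmx_diag _)^T]mulmxA -expmx_diag_half.
split=> //; rewrite expmx_diagT -!(mulmxA g) -!expmx_diagD.
rewrite addrAC -scalerDl (_ : 2^-1 + 2^-1 = 1) ?scale1r ?subrr ?expmx_diag0 ?mul1mx //.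
by field.
Qed.

Lemma relative_log_exists g h : g \in unitmx -> h \in unitmx ->
  exists x, relative_log (g *m g^T) (h *m h^T) x.
Proof.
move=> gu hu; pose k := invmx g *m h; have hE : h = g *m k by rewrite mulKVmx.
have ku : k \in unitmx by rewrite unitmx_mul unitmx_inv gu.
have [U UU [x xE]] := gram_spectral ku; exists x, (g *m U).
  by rewrite unitmx_mul gu orthogonal_unit.
rewrite trmx_mul; split; first by rewrite mulmxA -(mulmxA g) UU mulmx1.
by rewrite hE trmx_mul mulmxA -(mulmxA g) xE !mulmxA.
Qed.

Lemma relative_log_grams P Q x : relative_log P Q x ->
  (exists2 g, g \in unitmx & P = g *m g^T) /\ (exists2 h, h \in unitmx & Q = h *m h^T).
Proof. by move=> [g gu [-> ->]]; split; [exists g | exact: gram_expmx_diag]. Qed.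

(** The vector is not unique, since its entries can be permuted, but the distance is. After moving
    [P] to [1], whose logarithm is 0, [frob_log_le_sqnorm] gives one inequality, and symmetry the
    other. *)
Lemma relative_log_sqnorm P Q x y :
  relative_log P Q x -> relative_log P Q y -> sqnorm x = sqnorm y.
Proof.
suff W P' Q' x' y' : relative_log P' Q' x' -> relative_log P' Q' y' -> sqnorm x' <= sqnorm y'.
  by move=> h1 h2; apply/eqP; rewrite eq_le (W _ _ _ _ h1 h2) (W _ _ _ _ h2 h1).
move=> [g gu [-> ->]] [h hu [E1 E2]].
have ku : invmx g *m h \in unitmx by rewrite unitmx_mul unitmx_inv gu.
have O1 : orthogonal (1%:M : 'M[R]_n) by rewrite /orthogonal trmx1 mulmx1.
have := @frob_log_le_sqnorm R n 1%:M 1%:M (invmx g *m h) 0 x' y' O1 O1 ku.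
rewrite !mul1mx !trmx1 !mulmx1 expmx_diag0 trmx_mul.
rewrite (_ : diag_mx 0 = 0); last by rewrite linear0.
rewrite sub0r {1}/frob [(- _)^T]linearN mulmxN mulNmx opprK -/(frob _) frob_diag; apply.
  rewrite !mulmxA -(mulmxA _ h) -E1 !mulmxA mulVmx // mul1mx -trmx_mul mulVmx // trmx1 //.
rewrite !mulmxA -2!(mulmxA (invmx g)) -E2 !mulmxA mulVmx // mul1mx -mulmxA -trmx_mul.
by rewrite mulVmx // trmx1 mulmx1.
Qed.

Lemma frob_interpolate (t : R) A B :
  frob B + t * (1 - t) * frob A =
  (1 - t) * frob (- t *: A - B) + t * frob ((1 - t) *: A - B).
Proof.
rewrite !frobE !mulr_sumr -!big_split; apply: eq_bigr => i _ /=.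
rewrite !mulr_sumr -!big_split; apply: eq_bigr => j _ /=; rewrite !mxE; ring.
Qed.

(* Nonpositive curvature: after moving the point of the geodesic to [1], this is
   the parallelogram identity in the tangent space. *)
Lemma relative_log_interpolate g x (t : R) S u v w : g \in unitmx -> 0 <= t -> t <= 1 ->
  relative_log (g *m g^T) S u -> relative_log (g *m expmx_diag x *m g^T) S v ->
  relative_log (g *m expmx_diag (t *: x) *m g^T) S w ->
  sqnorm w + t * (1 - t) * sqnorm x <= (1 - t) * sqnorm u + t * sqnorm v.
Proof.
move=> gu t0 t1 [a au [aP aS]] [b bu [bQ bS]] [c cu [cM cS]].
(* [q q^T] is the point at time [t]; its inverse frame [k] moves it to [1] and the endpoints to
   [exp (- t x)] and [exp ((1 - t) x)]. Logarithms at [1] preserve the distance to [S] from there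
   and do not increase the two others. *)
pose e := expmx_diag (2^-1 *: (t *: x)); have [q qE] : exists q, q = g *m e by exists (g *m e).
pose k := invmx q.
have geu : q \in unitmx by rewrite qE unitmx_mul gu expmx_diag_unit.
have ku : k \in unitmx by rewrite unitmx_inv.
have kE y : k *m (g *m expmx_diag y *m g^T) *m k^T = expmx_diag (y - t *: x).
  have -> : g *m expmx_diag y *m g^T = q *m expmx_diag (y - t *: x) *m q^T.
    rewrite qE trmx_mul /e expmx_diagT !mulmxA -!(mulmxA g) -!expmx_diagD.
    congr (_ *m (expmx_diag _ *m _)); apply/rowP => i; rewrite !mxE; by field.
  by rewrite !mulmxA mulVmx // mul1mx -mulmxA -trmx_mul mulVmx // trmx1 mulmx1.
have k1 : k *m (g *m g^T) *m k^T = expmx_diag (- t *: x).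
  by have := kE 0; rewrite expmx_diag0 mulmx1 sub0r scaleNr.
have kx : k *m (g *m expmx_diag x *m g^T) *m k^T = expmx_diag ((1 - t) *: x).
  by rewrite kE scalerBl scale1r.
have VV : orthogonal (k *m c).
  rewrite /orthogonal trmx_mul mulmxA -(mulmxA k) -cM kE subrr expmx_diag0 //.
have O1 : orthogonal (1%:M : 'M[R]_n) by rewrite /orthogonal trmx1 mulmx1.
have kS y d : S = d *m expmx_diag y *m d^T ->
    k *m c *m expmx_diag w *m (k *m c)^T = k *m d *m expmx_diag y *m (k *m d)^T.
  move=> dS; rewrite !trmx_mul; transitivity (k *m S *m k^T).
    by rewrite cS !mulmxA.
  by rewrite dS !mulmxA.
have hu : frob (diag_mx (- t *: x) - k *m c *m diag_mx w *m (k *m c)^T) <= sqnorm u.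
  have := @frob_log_le_sqnorm R n 1%:M (k *m c) (k *m a) (- t *: x) w u O1 VV.
  rewrite unitmx_mul ku au !mul1mx !trmx1 !mulmx1; apply=> //; last exact: kS.
  by rewrite -k1 aP trmx_mul !mulmxA.
have hv : frob (diag_mx ((1 - t) *: x) - k *m c *m diag_mx w *m (k *m c)^T) <= sqnorm v.
  have := @frob_log_le_sqnorm R n 1%:M (k *m c) (k *m b) ((1 - t) *: x) w v O1 VV.
  rewrite unitmx_mul ku bu !mul1mx !trmx1 !mulmx1; apply=> //; last exact: kS.
  by rewrite -kx bQ trmx_mul !mulmxA.
rewrite -(frob_diag x) -(frob_diag w) -(frob_conj _ VV) frob_interpolate.
move: hu hv; rewrite ![diag_mx (_ *: x)]linearZ /= => hu hv.
apply: lerD; apply: ler_wpM2l => //.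
by rewrite subr_ge0.
Qed.

(** The case [t = 1/2] of the interpolation, known as the CN inequality of Bruhat and Tits. [S] is
    quantified after [M], so one midpoint serves several comparisons. *)
Lemma relative_log_midpoint P Q p : relative_log P Q p ->
  exists2 M, exists2 h, h \in unitmx & M = h *m h^T &
  forall S u v w, relative_log P S u -> relative_log Q S v -> relative_log M S w ->
    sqnorm w + 4^-1 * sqnorm p <= 2^-1 * sqnorm u + 2^-1 * sqnorm v.
Proof.
move=> [g gu [-> ->]]; exists (g *m expmx_diag (2^-1 *: p) *m g^T).
  exact: gram_expmx_diag.
move=> S u v w uS vS wS.
have h1 : (0 : R) <= 2^-1 by rewrite invr_ge0.
have h2 : (2^-1 : R) <= 1 by lra.
have := relative_log_interpolate gu h1 h2 uS vS wS.
have -> : (1 : R) - 2^-1 = 2^-1 by field.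
by have -> : (2^-1 * 2^-1 : R) = 4^-1 by field.
Qed.

(** The midpoint inequality for the diagonal [P S] is applied to [Q] and to [T], then the one for
    the diagonal [Q T] to the midpoint of [P S]; the distance between the two midpoints is
    dropped. *)
Lemma relative_log_quadrilateral P Q S T pq qs st tp ps qt :
  relative_log P Q pq -> relative_log Q S qs -> relative_log S T st ->
  relative_log T P tp -> relative_log P S ps -> relative_log Q T qt ->
  sqnorm ps + sqnorm qt <= sqnorm pq + sqnorm qs + sqnorm st + sqnorm tp.
Proof.
move=> PQ QS ST TP PS QT.
have [_ [h hu Qh]] := relative_log_grams PQ; have [_ [k ku Tk]] := relative_log_grams ST.
have [M [m mu Mm] hM] := relative_log_midpoint PS.
have [M' [m' mu' Mm'] hM'] := relative_log_midpoint QT.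
have [x MQ] := relative_log_exists mu hu; have [y MT] := relative_log_exists mu ku.
have [z MM] := relative_log_exists mu' mu.
rewrite -Mm -?Mm' -?Qh -?Tk in MQ MT MM.
have i1 := hM _ _ _ _ PQ (relative_log_sym QS) MQ.
have i2 := hM _ _ _ _ (relative_log_sym TP) ST MT.
have i3 := hM' _ _ _ _ (relative_log_sym MQ) (relative_log_sym MT) MM.
rewrite !sqnormN in i1 i2 i3; have := sqnorm_ge0 z.
clear -i1 i2 i3; lra.
Qed.

End SymmetricSpace.

(** * Projection to a totally geodesic orbit *)

Section Projection.
Variables (R : realType) (n : nat) (H : 'M[R]_n -> Prop).
Hypothesis Hunit : forall a, H a -> a \in unitmx.
Hypothesis H1 : H 1%:M.
Hypothesis HM : forall a b, H a -> H b -> H (a *m b).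
Hypothesis HV : forall a, H a -> H (invmx a).
Hypothesis HT : forall a, H a -> H a^T.
Hypothesis Hpow : forall U x, orthogonal U -> H (U *m expmx_diag x *m U^T) ->
  forall t, H (U *m expmx_diag (t *: x) *m U^T).

(* First variation at the almost nearest point [1]; [t] bounds the error. *)
Lemma projection_inequality (I t : R) Q u c z v : 0 < t -> t <= 1 ->
  (forall h w, H h -> relative_log Q (h *m h^T) w -> I <= sqnorm w) ->
  relative_log Q 1%:M u -> sqnorm u <= I + t ^+ 2 ->
  H c -> relative_log 1%:M (c *m c^T) z -> relative_log Q (c *m c^T) v ->
  sqnorm u + (1 - t) * sqnorm z - t <= sqnorm v.
Proof.
move=> t0 t1 QI Qu uI Hc cz cv.
have [V VV [y yE]] := gram_spectral (Hunit Hc).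
have VI : V *m V^T = 1%:M by [].
have cy : relative_log 1%:M (c *m c^T) y.
  by exists V; [exact: orthogonal_unit | rewrite VI].
rewrite (relative_log_sqnorm cz cy).
have Hy s : H (V *m expmx_diag (s *: y) *m V^T).
  by apply: Hpow => //; rewrite -yE; apply: HM => //; exact: HT.
(* [k k^T] is the point at time [t] of the geodesic from [1] to [c c^T]. By [Hpow] it lies in the
   orbit, so its squared distance from [Q] is at least [I]. *)
set k := V *m expmx_diag ((2^-1 * t) *: y) *m V^T.
have kk : k *m k^T = V *m expmx_diag (t *: y) *m V^T.
  rewrite (expmx_diag_half (t *: y)) /k scalerA !trmx_mul trmxK !mulmxA.
  by rewrite -(mulmxA _ V^T V) orthogonalC // mulmx1.
have [_ [q qu]] := relative_log_grams (relative_log_sym Qu); move=> QE.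
have [w kw] := relative_log_exists qu (Hunit (Hy (2^-1 * t))).
have {}kw : relative_log Q (k *m k^T) w by rewrite QE.
have Iw := QI _ _ (Hy _) kw.
have := @relative_log_interpolate R n V y t Q (- u) (- v) (- w) (orthogonal_unit VV) (ltW t0) t1.
rewrite VI -kk -yE !sqnormN.
move=> /(_ (relative_log_sym Qu) (relative_log_sym cv) (relative_log_sym kw)) h.
rewrite -(ler_pM2l t0); have := sqnorm_ge0 y; move: uI Iw h.
move: (sqnorm _) (sqnorm _) (sqnorm _) (sqnorm _) => a b e d uI Iw h d0.
nra.
Qed.

(** [Q] is moved to [Q'] so that its almost nearest orbit point becomes [1]. In the quadrilateral
    [Q'], [1], [b b^T], [b Q' b^T] both diagonals are bounded below by [projection_inequality],
    applied to [b] and to [b^-1]. The quadrilateral inequality leaves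
    [(1 - 2 t) |y|^2 <= |d_i|^2 + 2 t]. *)
Lemma projection_contracts f (a : 'I_f -> 'M[R]_n) (d : 'I_f -> 'rV[R]_n) q :
  q \in unitmx -> (forall i, H (a i)) ->
  (forall i, relative_log (q *m q^T) (a i *m (q *m q^T) *m (a i)^T) (d i)) ->
  exists2 h, H h & forall i, exists2 y,
    relative_log 1%:M (h *m a i *m invmx h *m (h *m a i *m invmx h)^T) y &
    sqnorm y <= sqnorm (d i) + 8.
Proof.
move=> qu Ha Qd; set Q := q *m q^T.
(* Small enough that [t |d_i|^2 + t <= 1/4] for all [i] at once, which keeps the total error below
   the additive constant 8. *)
pose t : R := (4 * (1 + \sum_i sqnorm (d i)))^-1.
have D0 : 0 <= \sum_i sqnorm (d i) by apply: sumr_ge0 => i _; exact: sqnorm_ge0.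
have t0 : 0 < t by rewrite invr_gt0; lra.
have td i : t * sqnorm (d i) + t <= 4^-1.
  have dD : sqnorm (d i) <= \sum_i sqnorm (d i).
    by rewrite (bigD1 i) //= lerDl; apply: sumr_ge0 => j _; exact: sqnorm_ge0.
  have tD : t * (1 + \sum_i sqnorm (d i)) = 4^-1.
    by rewrite /t; field; apply/lt0r_neq0; lra.
  rewrite -tD mulrDr mulr1 addrC lerD2l; apply: ler_wpM2l => //; exact: ltW.
have t4 : t <= 4^-1.
  by rewrite lef_pV2 ?posrE; lra.
pose D : set R := fun s => exists h u, [/\ H h, relative_log Q (h *m h^T) u & s = sqnorm u].
have Dne : (D !=set0)%classic.
  have [u Qu] := relative_log_exists qu (unitmx1 R n).
  by exists (sqnorm u), 1%:M, u.
have Dlb : has_lbound D.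
  by exists 0 => _ [h [u [_ _ ->]]]; exact: sqnorm_ge0.
have t2 : 0 < t ^+ 2 by rewrite exprn_gt0.
have [_ [h0 [u [Hh0 Qu ->]]] uI] := inf_adherent t2 (conj Dne Dlb).
have h0u := Hunit Hh0; pose h := invmx h0.
have hu : h \in unitmx by rewrite unitmx_inv.
have Hh : H h by exact: HV.
have [Q' QE] : exists Q', Q' = h *m Q *m h^T by eexists.
have Q'u : relative_log Q' 1%:M u.
  rewrite QE; have := relative_log_conj hu Qu.
  by rewrite !mulmxA mulVmx // mul1mx -trmx_mul mulVmx // trmx1.
have Q'I k w : H k -> relative_log Q' (k *m k^T) w -> inf D <= sqnorm w.
  move=> Hk Qw; apply: ge_inf => //; exists (h0 *m k), w; split=> //; first exact: HM.
  have := relative_log_conj h0u Qw.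
  rewrite QE trmx_mul !mulmxA mulmxV // mul1mx -mulmxA -trmx_mul mulmxV // trmx1 mulmx1 //.
have Q'q : Q' = (h *m q) *m (h *m q)^T by rewrite QE trmx_mul !mulmxA.
have hqu : h *m q \in unitmx by rewrite unitmx_mul hu.
exists h => // i; set b := h *m a i *m invmx h.
have Hb : H b by apply: HM; [exact: HM | exact: HV].
have bu := Hunit Hb; have biu : invmx b \in unitmx by rewrite unitmx_inv.
have hinv : invmx h = h0 by rewrite invmxK.
have Qb : relative_log Q' (b *m Q' *m b^T) (d i).
  have := relative_log_conj hu (Qd i); rewrite -/Q -QE; congr relative_log.
  rewrite QE /b hinv !trmx_mul !mulmxA -(mulmxA _ h0 h) mulmxV // mulmx1.
  by rewrite -(mulmxA _ h^T h0^T) -trmx_mul mulmxV // trmx1 mulmx1.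
have [y by_] := relative_log_exists (unitmx1 R n) bu.
rewrite trmx1 mulmx1 in by_.
have [v Qv] := relative_log_exists hqu bu; rewrite -Q'q in Qv.
have [v' Qv'] := relative_log_exists hqu biu; rewrite -Q'q in Qv'.
have [y' by'] := relative_log_exists (unitmx1 R n) biu.
rewrite trmx1 mulmx1 in by'.
have bb : b *m (invmx b *m (invmx b)^T) *m b^T = 1%:M.
  by rewrite !mulmxA mulmxV // mul1mx -trmx_mul mulmxV // trmx1.
(* An isometry and its inverse displace the base point equally. *)
have yy : sqnorm y' = sqnorm y.
  have := relative_log_conj bu by'; rewrite bb mulmx1 => /relative_log_sym h1.
  by rewrite -sqnormN; apply: relative_log_sqnorm h1 by_.
have bQv : relative_log 1%:M (b *m Q' *m b^T) (- v').
  by have := relative_log_conj bu Qv'; rewrite bb => /relative_log_sym.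
have bQu : relative_log (b *m b^T) (b *m Q' *m b^T) (- u).
  by have := relative_log_conj bu Q'u; rewrite mulmx1 => /relative_log_sym.
exists y => //.
have quad := relative_log_quadrilateral Q'u by_ bQu (relative_log_sym Qb) Qv bQv.
have t1 : t <= 1 by lra.
have p1 := projection_inequality t0 t1 Q'I Q'u (ltW uI) Hb by_ Qv.
have p2 := projection_inequality t0 t1 Q'I Q'u (ltW uI) (HV Hb) by' Qv'.
rewrite yy in p2; rewrite !sqnormN in quad.
have := td i; have := sqnorm_ge0 y; have := sqnorm_ge0 (d i).
clear -quad p1 p2 t4 t0; move: (sqnorm _) (sqnorm _) (sqnorm _) (sqnorm _) (sqnorm _) quad p1 p2.
move=> A B C E F quad p1 p2; nra.
Qed.

End Projection.

(** * Norms and displacements *)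

Lemma sum_sqr_le_sqr_sum (R : realType) (I : finType) (F : I -> R) :
  (forall i, 0 <= F i) -> \sum_i F i ^+ 2 <= (\sum_i F i) ^+ 2.
Proof.
move=> F0; rewrite expr2 mulr_suml; apply: ler_sum => i _.
rewrite expr2; apply: ler_wpM2l => //; rewrite (bigD1 i) //= lerDl.
exact: sumr_ge0.
Qed.

Lemma sum_expR_ge1 (R : realType) n (x : 'rV[R]_n.+1) :
  \sum_i x 0 i = 0 -> 1 <= \sum_i expR (x 0 i).
Proof.
move=> x0; have [i xi] : exists i, 0 <= x 0 i.
  apply/existsP; apply: contraT; rewrite negb_exists => /forallP xneg.
  move/eqP: x0; rewrite lt_eqF // big_ord_recl; apply: ltr_nwDl.
    by have := xneg ord0; rewrite -ltNge.
  by apply: sumr_le0 => i _; have := xneg (lift ord0 i); rewrite -ltNge => /ltW.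
apply: (@le_trans _ _ (expR (x 0 i))); first by rewrite -expR0 ler_expR.
by rewrite (bigD1 i) //= lerDl; apply: sumr_ge0 => j _; exact: expR_ge0.
Qed.

(* On [\sum x = 0] an upper bound [b] for the entries gives
   [sqnorm x <= (N - 1) N b^2], and conversely [N y_i^2 <= (N - 1) sqnorm y]; the
   two factors combine to the exponent [N - 1]. *)
Lemma sum_expR_le (R : realType) n (x y : 'rV[R]_n.+2) :
  \sum_i x 0 i = 0 -> \sum_i y 0 i = 0 -> sqnorm y <= sqnorm x + 8 ->
  \sum_i expR (y 0 i) <= n.+2%:R * expR 3 * (\sum_i expR (x 0 i)) ^+ n.+1.
Proof.
move=> x0 y0 yx; set beta := \sum_i expR (x 0 i).
have xbeta i : expR (x 0 i) <= beta.
  by rewrite /beta (bigD1 i) //= lerDl; apply: sumr_ge0 => j _; exact: expR_ge0.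
have beta1 : 1 <= beta by exact: sum_expR_ge1.
pose b := ln beta; have bE : expR b = beta.
  by rewrite lnK // posrE; exact: lt_le_trans beta1.
have b0 : 0 <= b by rewrite -ler_expR expR0 bE.
have xb i : x 0 i <= b by rewrite -ler_expR bE.
have N0 : 0 < n.+1%:R :> R by rewrite ltr0n.
have N2 : n.+2%:R = n.+1%:R + 1 :> R by rewrite -[n.+2]addn1 natrD.
(* The numbers [b - x_i] are nonnegative, so the sum of their squares is at most the square of their
   sum. *)
have sx : sqnorm x <= (n.+1%:R + 1) * n.+1%:R * b ^+ 2.
  have := @sum_sqr_le_sqr_sum R _ (fun i => b - x 0 i).
  have -> : \sum_i (b - x 0 i) = n.+2%:R * b.
    by rewrite sumrB x0 subr0 sumr_const card_ord mulr_natl.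
  have -> : \sum_i (b - x 0 i) ^+ 2 = n.+2%:R * b ^+ 2 + sqnorm x.
    under eq_bigr do rewrite sqrrB.
    rewrite big_split sumrB /= sumr_const card_ord /sqnorm.
    by rewrite sumrMnl -mulr_sumr x0 mulr0 mul0rn subr0 (mulr_natl (b ^+ 2)).
  rewrite N2 => /(_ (fun i => etrans (subr_ge0 _ _) (xb i))) h; clear -h; lra.
(* The other entries have mean [- y_i / (n + 1)]; expanding their squared deviations from it gives
   the bound. *)
have sy i : (n.+1%:R + 1) * y 0 i ^+ 2 <= n.+1%:R * sqnorm y.
  have h : 0 <= \sum_(j | j != i) (y 0 j + y 0 i / n.+1%:R) ^+ 2.
    by apply: sumr_ge0 => j _; exact: sqr_ge0.
  move: h; under eq_bigr do rewrite sqrrD.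
  rewrite !big_split /= sumr_const -mulr_suml.
  have -> : #|[pred j | j != i]| = n.+1.
    by have := cardC1 i; rewrite card_ord /= => E; rewrite -[RHS]E; apply: eq_card => j; rewrite !inE.
  have -> : \sum_(j | j != i) y 0 j = - y 0 i.
    by move/eqP: y0; rewrite (bigD1 i) //= addr_eq0 => /eqP ->; rewrite opprK.
  have -> : sqnorm y = y 0 i ^+ 2 + \sum_(j | j != i) y 0 j ^+ 2.
    by rewrite /sqnorm (bigD1 i).
  move: (\sum_(j | j != i) _) (y 0 i) => S u.
  have -> : S + (- u * (u / n.+1%:R) + - u * (u / n.+1%:R)) + (u / n.+1%:R) ^+ 2 *+ n.+1 = S - u ^+ 2 / n.+1%:R.
    rewrite -(mulr_natl (_ ^+ 2)); move: n.+1%:R N0 => N N0; field; exact: lt0r_neq0.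
  by rewrite subr_ge0 ler_pdivrMr // => h; clear -h; lra.
(* The 3 absorbs the additive 8, as [(B + 3)^2 > B^2 + 8] for [B >= 0]. *)
have yb i : y 0 i <= n.+1%:R * b + 3.
  have h := sy i; have : y 0 i ^+ 2 <= n.+1%:R ^+ 2 * b ^+ 2 + 8.
    rewrite -(ler_pM2l (_ : 0 < n.+1%:R + 1)); last by lra.
    apply: (le_trans h); apply: (@le_trans _ _ (n.+1%:R * ((n.+1%:R + 1) * n.+1%:R * b ^+ 2 + 8))).
      by apply: ler_wpM2l; [exact: ltW | apply: (le_trans yx); rewrite lerD2r].
    by rewrite -subr_ge0 (_ : _ - _ = 8); [lra | ring].
  move=> h2; have NB : 0 <= n.+1%:R * b by rewrite mulr_ge0 // ltW.
  rewrite leNgt; apply/negP => yi.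
  have : (n.+1%:R * b + 3) ^+ 2 < y 0 i ^+ 2 by rewrite ltr_sqr ?nnegrE; lra.
  move: NB h2; rewrite -exprMn; move: (n.+1%:R * b) => B B0 h2 h3; clear -B0 h2 h3; lra.
have ey i : expR (y 0 i) <= expR 3 * beta ^+ n.+1.
  by rewrite -bE -expRM_natl -expRD ler_expR addrC.
apply: (le_trans (ler_sum _ (fun i _ => ey i))).
by rewrite sumr_const card_ord -mulrA mulr_natl.
Qed.

(** The frame [g] is orthogonal here, so the numbers [exp y_i] are the squared singular values of
    [b]. *)
Lemma relative_log1 (R : realType) n (b : 'M[R]_n) y :
  \det b = 1 -> relative_log 1%:M (b *m b^T) y ->
  frob b = \sum_i expR (y 0 i) /\ \sum_i y 0 i = 0.
Proof.
move=> db [g gu [gI bE]]; have OO : orthogonal g by [].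
have gg : g^T *m g = 1%:M by exact: orthogonalC.
split.
  rewrite /frob bE mxtrace_mulC mulmxA gg mul1mx mxtrace_diag.
  by apply: eq_bigr => i _; rewrite mxE.
have : \det (b *m b^T) = \det (g^T *m g) * expR (\sum_i y 0 i).
  rewrite bE !det_mulmx det_tr det_diag expR_sum.
  under eq_bigr do rewrite mxE.
  by ring.
rewrite gg det1 det_mulmx det_tr db !mul1r -expR0 => /expR_inj //.
Qed.

(** * Real powers in Zariski closed groups *)

Lemma poly_interpolation (F : fieldType) (s : seq F) (f : F -> F) :
  exists p : {poly F}, forall x, x \in s -> p.[x] = f x.
Proof.
elim: s => [|a s [p pE]]; first by exists 0.
have [as_|as_] := boolP (a \in s).
  by exists p => x; rewrite inE => /orP[/eqP ->|]; apply: pE.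
pose w := \prod_(y <- s) ('X - y%:P).
have wa : w.[a] != 0 by rewrite -[_ == 0]/(root w a) root_prod_XsubC.
exists (p + ((f a - p.[a]) / w.[a]) *: w) => x; rewrite inE hornerD hornerZ.
have [-> _|_ /= xs] := eqVneq x a; first by rewrite divfK // addrC subrK.
by rewrite (_ : w.[x] = 0) ?mulr0 ?addr0 ?pE //; apply/eqP; rewrite -[_ == 0]/(root w x) root_prod_XsubC.
Qed.

(** The complex coefficients come from the equations of the group, the real exponents from
    logarithms of eigenvalues. *)
Definition exponential_sum (R : realType) (F : R -> R[i]) : Prop :=
  exists s : seq (R[i] * R), forall t, F t = \sum_(q <- s) q.1 * (expR (t * q.2))%:C%C.

Section ExponentialSums.
Variable R : realType.
Implicit Types F : R -> R[i].

Lemma exponential_sum_ext F F' : F =1 F' -> exponential_sum F -> exponential_sum F'.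
Proof. by move=> FF' [s sE]; exists s => t; rewrite -FF'. Qed.

Lemma exponential_sum_exp (c : R[i]) (a : R) : exponential_sum (fun t : R => c * (expR (t * a))%:C%C).
Proof. by exists [:: (c, a)] => t; rewrite big_seq1. Qed.

Lemma exponential_sum_cst (c : R[i]) : exponential_sum (fun _ : R => c).
Proof.
apply: exponential_sum_ext (exponential_sum_exp c 0) => t.
by rewrite mulr0 expR0 rmorph1 mulr1.
Qed.

Lemma exponential_sumD F F' : exponential_sum F -> exponential_sum F' ->
  exponential_sum (fun t => F t + F' t).
Proof. by move=> [s sE] [s' sE']; exists (s ++ s') => t; rewrite big_cat sE sE'. Qed.

Lemma exponential_sumM F F' : exponential_sum F -> exponential_sum F' ->
  exponential_sum (fun t => F t * F' t).
Proof.
move=> [s sE] [s' sE'].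
exists [seq (q.1 * q'.1, q.2 + q'.2) | q <- s, q' <- s'] => t.
rewrite big_allpairs_dep /= sE sE' mulr_suml; apply: eq_bigr => q _.
rewrite mulr_sumr; apply: eq_bigr => q' _.
by rewrite mulrDr expRD rmorphM mulrACA.
Qed.

Lemma exponential_sum_sum (I : Type) (r : seq I) (F : I -> R -> R[i]) :
  (forall i, exponential_sum (F i)) -> exponential_sum (fun t => \sum_(i <- r) F i t).
Proof.
move=> FE; elim: r => [|i r IH].
  by apply: exponential_sum_ext (exponential_sum_cst 0) => t; rewrite big_nil.
by apply: exponential_sum_ext (exponential_sumD (FE i) IH) => t; rewrite big_cons.
Qed.

Lemma exponential_sum_prod (I : Type) (r : seq I) (F : I -> R -> R[i]) :
  (forall i, exponential_sum (F i)) -> exponential_sum (fun t => \prod_(i <- r) F i t).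
Proof.
move=> FE; elim: r => [|i r IH].
  by apply: exponential_sum_ext (exponential_sum_cst 1) => t; rewrite big_nil.
by apply: exponential_sum_ext (exponential_sumM (FE i) IH) => t; rewrite big_cons.
Qed.

Lemma exponential_sumX F k : exponential_sum F -> exponential_sum (fun t => F t ^+ k).
Proof.
move=> FE; elim: k => [|k IH].
  by apply: exponential_sum_ext (exponential_sum_cst 1) => t; rewrite expr0.
by apply: exponential_sum_ext (exponential_sumM FE IH) => t; rewrite exprS.
Qed.

(* For a fixed [t], interpolate [u |-> u^t] at the numbers [exp a_k] by a
   polynomial: this writes [F t] as a combination of values at integers. *)
Lemma exponential_sum_eq0 F : exponential_sum F -> (forall k : nat, F k%:R = 0) ->
  forall t, F t = 0.
Proof.
move=> [s sE] F0 t.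
have [p pE] := poly_interpolation [seq expR q.2 | q <- s] (fun x => x `^ t).
have -> : F t = \sum_(j < size p) (p`_j)%:C%C * F j%:R.
  under [RHS]eq_bigr => j _ do rewrite sE mulr_sumr.
  rewrite exchange_big sE big_seq [RHS]big_seq /=; apply: eq_bigr => q qs.
  have -> : expR (t * q.2) = p.[expR q.2].
    by rewrite pE; [rewrite -expRM mulrC | apply: map_f].
  rewrite horner_coef rmorph_sum mulr_sumr.
  by apply: eq_bigr => j _; rewrite rmorphM /= -expRM_natl mulrCA.
by rewrite big1 // => j _; rewrite F0 mulr0.
Qed.

End ExponentialSums.

(** Along the one-parameter group every matrix entry, hence every defining polynomial, is an
    exponential sum in [t]. It vanishes at natural [t], where the matrix is a power of a group
    element. *)
Lemma real_points_power (R : realType) n (G : set 'M[R[i]]_n) (U : 'M[R]_n) (x : 'rV[R]_n) :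
  matrix_group G -> zariski_closed G -> orthogonal U ->
  real_points G (U *m expmx_diag x *m U^T) ->
  forall t, real_points G (U *m expmx_diag (t *: x) *m U^T).
Proof.
move=> [_ G1 GM _] [S GS] UU Gx t.
have Gk (k : nat) : real_points G (U *m expmx_diag (k%:R *: x) *m U^T).
  elim: k => [|k IH].
    by rewrite scale0r expmx_diag0 mulmx1 UU /real_points /= map_mx1.
  have -> : U *m expmx_diag (k.+1%:R *: x) *m U^T =
      (U *m expmx_diag x *m U^T) *m (U *m expmx_diag (k%:R *: x) *m U^T).
    rewrite !mulmxA -(mulmxA _ U^T U) orthogonalC // mulmx1 -(mulmxA U (expmx_diag x)) -expmx_diagD.
    by rewrite -[k.+1]add1n natrD scalerDl scale1r.
  by rewrite /real_points /= map_mxM; apply: GM.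
rewrite /real_points /= GS /= => p Sp.
pose F t := mxeval (map_mx (real_complex R) (U *m expmx_diag (t *: x) *m U^T)) p.
apply: (@exponential_sum_eq0 R F); last first.
  by move=> k; have := Gk k; rewrite /real_points /= GS; apply.
rewrite /F /mxeval; apply: exponential_sum_ext => [u|]; first by rewrite mpoly.mevalE.
apply: exponential_sum_sum => m; apply: exponential_sumM; first exact: exponential_sum_cst.
apply: exponential_sum_prod => i; apply: exponential_sumX.
case/mxvec_indexP: i => a b.
apply: (@exponential_sum_ext _ (fun u => \sum_c (U a c * U b c)%:C%C * (expR (u * x 0 c))%:C%C)).
  move=> u; rewrite mxvecE !mxE rmorph_sum; apply: eq_bigr => c _.
  by rewrite mul_mx_diag !mxE -!rmorphM /=; congr (_%:C%C); ring.
by apply: exponential_sum_sum => c; exact: exponential_sum_exp.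
Qed.

(** [a_i] displaces [g^-1 (g^-1)^T] exactly as [g a_i g^-1] displaces [1]. Projection gives a
    conjugate under [H] whose displacements at [1] are at most slightly larger, [sum_expR_le] turns
    displacements into norms, and minimality passes the bound to [a]. *)
Lemma minimal_frob_le (R : realType) n (H : 'M[R]_n.+2 -> Prop) f (a : 'I_f -> 'M[R]_n.+2) :
  (forall h, H h -> h \in unitmx) -> H 1%:M ->
  (forall h k, H h -> H k -> H (h *m k)) -> (forall h, H h -> H (invmx h)) ->
  (forall h, H h -> H h^T) ->
  (forall U x, orthogonal U -> H (U *m expmx_diag x *m U^T) ->
    forall t, H (U *m expmx_diag (t *: x) *m U^T)) ->
  (forall h, H h -> \det h = 1) -> (forall i, H (a i)) ->
  (forall h, H h -> \sum_i frob (a i) <= \sum_i frob (h *m a i *m invmx h)) ->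
  forall g, g \in unitmx ->
  \sum_i frob (a i) <=
  f%:R * (n.+2%:R * expR 3) * (\sum_i frob (g *m a i *m invmx g)) ^+ n.+1.
Proof.
move=> Hunit H1 HM HV HT Hpow Hdet Ha amin g gu; set beta := \sum_i frob (g *m _ *m _).
have giu : invmx g \in unitmx by rewrite unitmx_inv.
have dex i : exists d, relative_log (invmx g *m (invmx g)^T)
    (a i *m (invmx g *m (invmx g)^T) *m (a i)^T) d.
  have aiu : a i *m invmx g \in unitmx by rewrite unitmx_mul Hunit.
  have [d dE] := relative_log_exists giu aiu; exists d.
  by move: dE; rewrite trmx_mul !mulmxA.
have [d dE] := choice dex.
have [h Hh hP] := projection_contracts Hunit H1 HM HV HT Hpow giu Ha dE.
apply: (le_trans (amin h Hh)).
have -> : f%:R * (n.+2%:R * expR 3) * beta ^+ n.+1 =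
    \sum_(i < f) (n.+2%:R * expR 3 * beta ^+ n.+1).
  by rewrite sumr_const card_ord -mulrA mulr_natl.
apply: ler_sum => i _; have [y yE yd] := hP i.
have hb : \det (h *m a i *m invmx h) = 1.
  exact: Hdet _ (HM _ _ (HM _ _ Hh (Ha i)) (HV _ Hh)).
have [-> y0] := relative_log1 hb yE.
have gb : \det (g *m a i *m invmx g) = 1.
  by rewrite !det_mulmx (Hdet _ (Ha i)) mulr1 det_inv divff // -unitfE -unitmxE.
have gd : relative_log 1%:M ((g *m a i *m invmx g) *m (g *m a i *m invmx g)^T) (d i).
  have := relative_log_conj gu (dE i).
  by rewrite !trmx_mul !mulmxA mulmxV // mul1mx -trmx_mul mulmxV // trmx1.
have [bE d0] := relative_log1 gb gd.
apply: (le_trans (sum_expR_le d0 y0 yd)); rewrite -bE.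
apply: ler_wpM2l; first by rewrite mulr_ge0 // expR_ge0.
apply: lerXn2r; rewrite ?nnegrE ?frob_ge0 //.
  by apply: sumr_ge0 => j _; exact: frob_ge0.
by rewrite /beta (bigD1 i) //= lerDl; apply: sumr_ge0 => j _; exact: frob_ge0.
Qed.

(** * Nil and nilpotent algebras *)

Section NagataHigman.
Variables (K : numFieldType) (A : algType K).
Implicit Types (x y z : A) (S J : A -> Prop).

(** A two-sided ideal of [S], where [S] may lack the unit of [A]. Working modulo [J] inside [A]
    replaces passing to quotient algebras. *)
Definition ideal_of S J : Prop :=
  [/\ forall x, J x -> S x, J 0, forall x y, J x -> J y -> J (x + y),
      forall (c : K) x, J x -> J (c *: x)
    & forall x y, S x -> J y -> J (x * y) /\ J (y * x)].

Lemma ideal_ofB S J x y : ideal_of S J -> J x -> J y -> J (x - y).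
Proof. by move=> [_ _ JD JZ _] Jx Jy; rewrite -scaleN1r; apply: JD => //; apply: JZ. Qed.

Lemma ideal_of_sum S J (I : Type) (r : seq I) (P : pred I) (F : I -> A) :
  ideal_of S J -> (forall i, P i -> J (F i)) -> J (\sum_(i <- r | P i) F i).
Proof. by move=> [_ J0 JD _ _] JF; apply: (big_ind J). Qed.

Lemma ideal_of_scaleK S J (c : K) x : ideal_of S J -> c != 0 -> J (c *: x) -> J x.
Proof.
by move=> [_ _ _ JZ _] c0 /(JZ c^-1); rewrite scalerA mulVf // scale1r.
Qed.

(* Eliminate the leading coefficient with [f (2 t) - 2^d f t]. *)
Lemma ideal_of_coef S J d (c : nat -> A) : ideal_of S J ->
  (forall t : K, J (\sum_(k < d) t ^+ k *: c k)) -> forall k, (k < d)%N -> J (c k).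
Proof.
move=> JI; have [_ J0 JD JZ _] := JI; elim: d c => // d IH c Jc.
have Jlt k : (k < d)%N -> J (c k).
  move=> kd; apply: (ideal_of_scaleK JI (_ : 2 ^+ k - 2 ^+ d != 0)).
    by rewrite subr_eq0 -!natrX eqr_nat eqn_exp2l // ltn_eqF.
  apply: (IH (fun k => (2 ^+ k - 2 ^+ d) *: c k)) => // t.
  have := ideal_ofB JI (Jc (2 * t)) (JZ (2 ^+ d) _ (Jc t)).
  rewrite !big_ord_recr /= scalerDr opprD addrACA exprMn scalerA subrr addr0.
  rewrite scaler_sumr -sumrB; congr J; apply: eq_bigr => i _.
  by rewrite exprMn !scalerA -scalerBl; congr (_ *: _); ring.
move=> k; rewrite ltnS leq_eqVlt => /orP[/eqP ->|]; last exact: Jlt.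
have := Jc 1; rewrite big_ord_recr /= expr1n scale1r => h.
have h2 : J (\sum_(i < d) 1 ^+ i *: c i).
  by apply: (ideal_of_sum _ JI) => i _; apply: (JZ); apply: Jlt.
by have := ideal_ofB JI h h2; rewrite addrAC subrr add0r.
Qed.

Fixpoint power_coef x y (m k : nat) : A :=
  if m is m'.+1 then
    x * power_coef x y m' k + (if k is k'.+1 then y * power_coef x y m' k' else 0)
  else (k == 0%N)%:R.

Lemma power_coef_gt x y m k : (m < k)%N -> power_coef x y m k = 0.
Proof.
elim: m k => [|m IH] [|k] //= mk; rewrite IH ?mulr0 ?add0r; last exact: ltnW.
by rewrite IH ?mulr0.
Qed.

Lemma exprD_power_coef x y (t : K) m :
  (x + t *: y) ^+ m = \sum_(k < m.+1) t ^+ k *: power_coef x y m k.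
Proof.
elim: m => [|m IH]; first by rewrite big_ord1 /= expr0 scale1r.
rewrite exprS IH mulrDl /= 2!mulr_sumr; under [RHS]eq_bigr do rewrite scalerDr.
rewrite big_split /=; congr (_ + _).
  rewrite [RHS]big_ord_recr /= power_coef_gt // mulr0 scaler0 addr0.
  by apply: eq_bigr => i _; rewrite scalerAr.
rewrite [RHS]big_ord_recl /= scaler0 add0r; apply: eq_bigr => i _.
by rewrite -scalerAr -scalerAl scalerA exprSr.
Qed.

Lemma power_coef0 x y m : power_coef x y m 0 = x ^+ m.
Proof. by elim: m => //= m ->; rewrite addr0 exprS. Qed.

Lemma power_coef1 x y m :
  power_coef x y m.+1 1 = \sum_(i < m.+1) x ^+ i * y * x ^+ (m - i).
Proof.
elim: m => [|m IH]; first by rewrite big_ord1 /= mulr0 add0r !mulr1 mul1r.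
rewrite -[LHS]/(x * power_coef x y m.+1 1 + y * power_coef x y m.+1 0).
rewrite IH power_coef0 [RHS]big_ord_recl addrC expr0 mul1r subn0.
congr (_ + _); rewrite mulr_sumr; apply: eq_bigr => i _.
by rewrite !mulrA -exprS subSS.
Qed.

(** The ideal of [S] generated by [J] and all [n]-th powers, given inductively so that statements
    about it can be proved generator by generator. *)
Inductive power_ideal S J n : A -> Prop :=
| PowerIdeal_incl x : J x -> power_ideal S J n x
| PowerIdeal_pow x : S x -> power_ideal S J n (x ^+ n)
| PowerIdealD x y : power_ideal S J n x -> power_ideal S J n y -> power_ideal S J n (x + y)
| PowerIdealZ (c : K) x : power_ideal S J n x -> power_ideal S J n (c *: x)
| PowerIdealMl x y : S x -> power_ideal S J n y -> power_ideal S J n (x * y)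
| PowerIdealMr x y : S x -> power_ideal S J n y -> power_ideal S J n (y * x).

Definition subalgebra S : Prop :=
  [/\ S 0, forall x y, S x -> S y -> S (x + y), forall (c : K) x, S x -> S (c *: x)
    & forall x y, S x -> S y -> S (x * y)].

Lemma subalgebraX S x n : subalgebra S -> S x -> S (x ^+ n.+1).
Proof.
move=> [_ _ _ SM] Sx; elim: n => [|n IH]; first by rewrite expr1.
by rewrite exprS; apply: SM.
Qed.

Lemma power_ideal_ideal S J n : subalgebra S -> ideal_of S J ->
  ideal_of S (power_ideal S J n.+1).
Proof.
move=> SA [JS J0 JD JZ JM]; have [S0 SD SZ SM] := SA; split.
- move=> x; elim=> {x} [x /JS //|x Sx|x y _ Sx _ Sy|c x _ Sx|x y Sx _ Sy|x y Sx _ Sy].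
  + exact: subalgebraX.
  + exact: SD.
  + exact: SZ.
  + exact: SM.
  + exact: SM.
- exact: PowerIdeal_incl.
- exact: PowerIdealD.
- exact: PowerIdealZ.
- by move=> x y Sx Jy; split; [apply: PowerIdealMl | apply: PowerIdealMr].
Qed.

(** This sum is the coefficient of [t] in [(x + t y)^(n+1)], which lies in [J] for every scalar
    [t]. *)
Lemma nil_linearized S J n x y : subalgebra S -> ideal_of S J ->
  (forall z, S z -> J (z ^+ n.+1)) -> S x -> S y ->
  J (\sum_(i < n.+1) x ^+ i * y * x ^+ (n - i)).
Proof.
move=> [S0 SD SZ SM] JI nil Sx Sy; rewrite -power_coef1.
apply: (@ideal_of_coef S J n.+2 (power_coef x y n.+1)) => // t.
by rewrite -exprD_power_coef; apply: nil; apply: SD => //; apply: SZ.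
Qed.

(* Higman's double sum over [x^i (z y^j) x^(n-i) y^(n-j)]. *)
Lemma nil_sandwich S J n x y z : subalgebra S -> ideal_of S J ->
  (forall z, S z -> J (z ^+ n.+1)) -> S x -> S y -> S z -> J (x ^+ n * z * y ^+ n).
Proof.
move=> SA JI nil Sx Sy Sz; have [S0 SD SZ SM] := SA; have [JS J0 JD JZ JM] := JI.
have JMl u v : (u = 1) \/ S u -> J v -> J (u * v).
  by move=> [->|Su] Jv; [rewrite mul1r | exact: (JM _ _ Su Jv).1].
have JMr u v : (u = 1) \/ S u -> J v -> J (v * u).
  by move=> [->|Su] Jv; [rewrite mulr1 | exact: (JM _ _ Su Jv).2].
have SX u k : S u -> (u ^+ k = 1) \/ S (u ^+ k).
  by move=> Su; case: k => [|k]; [left | right; exact: subalgebraX].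
have SzX k : S (z * y ^+ k).
  by case: (SX y k Sy) => [->|Sk]; [rewrite mulr1 | exact: SM].
have h1 : J (\sum_(j < n.+1) \sum_(i < n.+1) x ^+ i * (z * y ^+ j) * x ^+ (n - i) * y ^+ (n - j)).
  apply: (ideal_of_sum _ JI) => j _; rewrite -mulr_suml; apply: (JMr _ _ (SX y (n - j)%N Sy)).
  exact: (nil_linearized SA JI nil Sx (SzX j)).
rewrite exchange_big big_ord_recr /= in h1.
(* For [i < n] the inner sum over [j] is the linearized identity for [y] around [x^(n-i)], an
   element of [S] as the exponent is positive. Only [i = n] survives, and its [n + 1] terms
   coincide. *)
have h2 : J (\sum_(i < n) \sum_(j < n.+1)
    x ^+ i * (z * y ^+ j) * x ^+ (n - i) * y ^+ (n - j)).
  apply: (ideal_of_sum _ JI) => i _.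
  have -> : \sum_(j < n.+1) x ^+ i * (z * y ^+ j) * x ^+ (n - i) * y ^+ (n - j) =
      x ^+ i * (z * \sum_(j < n.+1) y ^+ j * x ^+ (n - i) * y ^+ (n - j)).
    by rewrite !mulr_sumr; apply: eq_bigr => j _; rewrite !mulrA.
  apply: (JMl _ _ (SX x i Sx)); apply: (JMl _ _ (or_intror Sz)).
  apply: (nil_linearized SA JI nil Sy); rewrite -(subnSK (ltn_ord i)); exact: subalgebraX.
have := ideal_ofB JI h1 h2; rewrite addrAC subrr add0r subnn expr0.
have -> : \sum_(j < n.+1) x ^+ n * (z * y ^+ j) * 1 * y ^+ (n - j) =
    n.+1%:R *: (x ^+ n * z * y ^+ n).
  under eq_bigr => j _ do rewrite mulr1 -!mulrA -exprD subnKC -1?ltnS //.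
  by rewrite sumr_const card_ord scaler_nat !mulrA.
by apply: (ideal_of_scaleK JI); rewrite pnatr_eq0.
Qed.

(** Induction on the exponent. Modulo the ideal [J'] generated by [J] and the next lower powers,
    words of length [m] vanish; a word of length [2 m + 1] therefore lies in [J' S J'], which
    [nil_sandwich] puts inside [J]. *)
Theorem nagata_higman n S J (s : seq A) : subalgebra S -> ideal_of S J ->
  (forall x, S x -> J (x ^+ n.+1)) -> (forall x, x \in s -> S x) ->
  size s = (2 ^ n.+1 - 1)%N -> J (\prod_(x <- s) x).
Proof.
move=> SA; have [S0 SD SZ SM] := SA.
elim: n J s => [|n IH] J s JI nil sS sz.
  case: s sz sS => [|x [|? ?]] //= _ sS.
  by rewrite big_seq1 -[x]expr1; apply: nil; apply: sS; rewrite mem_head.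
have [JS J0 JD JZ JM] := JI.
have JJ := power_ideal_ideal n SA JI; have [JJS _ _ _ _] := JJ.
have sandwich u a v : power_ideal S J n.+1 u -> S a -> power_ideal S J n.+1 v ->
    J (u * a * v).
  move=> Ju; elim: Ju a v => {u}.
  - move=> u Ju a v Sa /JJS Sv; rewrite -mulrA.
    by have [] := JM (a * v) u (SM _ _ Sa Sv) Ju.
  - move=> x Sx a v Sa Jv; elim: Jv a Sa => {v}.
    + move=> v Jv a Sa; have [h _] := JM (x ^+ n.+1 * a) v (SM _ _ (subalgebraX n SA Sx) Sa) Jv.
      exact: h.
    + by move=> y Sy a Sa; exact: (nil_sandwich SA JI nil Sx Sy Sa).
    + by move=> v w _ IHv _ IHw a Sa; rewrite mulrDr; apply: (JD); [exact: IHv | exact: IHw].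
    + by move=> c v _ IHv a Sa; rewrite -scalerAr; apply: (JZ); exact: IHv.
    + move=> b v Sb _ IHv a Sa; rewrite mulrA -(mulrA _ a b); apply: (IHv); exact: SM.
    + move=> b v Sb _ IHv a Sa; rewrite mulrA.
      by have [_] := JM b _ Sb (IHv a Sa).
  - by move=> u w _ IHu _ IHw a v Sa Jv; rewrite !mulrDl; apply: (JD); [exact: IHu | exact: IHw].
  - by move=> c u _ IHu a v Sa Jv; rewrite -!scalerAl; apply: (JZ); exact: IHu.
  - move=> b u Sb _ IHu a v Sa Jv; rewrite -!mulrA.
    by have [h _] := JM b _ Sb (IHu a v Sa Jv); rewrite !mulrA in h *.
  - by move=> b u Sb _ IHu a v Sa Jv; rewrite -(mulrA u b); apply: (IHu) => //; exact: SM.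
pose m := (2 ^ n.+1 - 1)%N.
have m2 : (2 ^ n.+2 - 1 = m + m.+1)%N.
  have : (0 < 2 ^ n.+1)%N by rewrite expn_gt0.
  by rewrite /m (expnS 2 n.+1) mul2n -addnn; case: (2 ^ n.+1)%N => // k _; rewrite !subn1.
rewrite m2 in sz.
rewrite -(cat_take_drop m s) big_cat /=.
have szd : size (drop m s) = m.+1 by rewrite size_drop sz addnC addnK.
case E : (drop m s) szd => [|a r] //= [szr]; rewrite big_cons mulrA.
have aS : S a by apply: sS; apply: (@mem_drop m); rewrite E mem_head.
have nil' x : S x -> power_ideal S J n.+1 (x ^+ n.+1) by move=> Sx; exact: PowerIdeal_pow.
apply: sandwich => //.
- apply: (IH (power_ideal S J n.+1)) => //; first by move=> x /mem_take; exact: sS.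
  by rewrite size_take sz; case: ltnP => //; rewrite leqNgt ltn_addl.
- apply: (IH (power_ideal S J n.+1)) => // x xr; apply: sS; apply: (@mem_drop m).
  by rewrite E inE xr orbT.
Qed.

End NagataHigman.

(** A rank factorization [E = C B] of an idempotent satisfies [B C = 1], so the trace is the rank,
    and characteristic 0 makes the rank 0. *)
Lemma idempotent_trace0 (F : numFieldType) n (E : 'M[F]_n) :
  E *m E = E -> \tr E = 0 -> E = 0.
Proof.
move=> EE tE; have EB := mulmx_base E.
have RC : row_base E *m col_base E = 1%:M.
  have : col_base E *m (row_base E *m col_base E) *m row_base E =
         col_base E *m 1%:M *m row_base E.
    by rewrite mulmx1 EB mulmxA EB -mulmxA EB.
  move/(row_free_inj (row_base_free E)) => h.
  have CF := col_base_full E.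
  by rewrite -(mul1mx (_ *m _)) -(mulVpmx CF) -mulmxA h mulmxA mulVpmx // mul1mx.
apply/eqP; rewrite -mxrank_eq0 -(pnatr_eq0 F); apply/eqP.
by rewrite -[RHS]tE -[in RHS]EB mxtrace_mulC RC mxtrace1.
Qed.

(* With [p = X^k q] the characteristic polynomial and [q 0 != 0], a Bezout
   relation between [X^(k+1)] and [q] gives an idempotent without constant term. *)
Lemma nilpotent_trace0 (F : numFieldType) n (x : 'M[F]_n.+1) :
  (forall j, \tr (x ^+ j.+1) = 0) -> x ^+ n.+1 = 0.
Proof.
move=> tr0; have p0 : char_poly x != 0 by rewrite monic_neq0 // char_poly_monic.
have [k [q q0 pE]] := multiplicity_XsubC (char_poly x) 0.
rewrite p0 /= polyC0 subr0 in q0 pE.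
have cop : coprimep ('X ^+ k.+1) q.
  by rewrite coprimep_expl // coprimep_sym -['X]subr0 -polyC0 coprimep_XsubC.
have [[u v] /= uv] := Bezout_eq1_coprimepP _ _ cop.
pose h := horner_mx x; have hX : h 'X = x by rewrite /h horner_mx_X.
have CH : h (q * 'X ^+ k) = 0 by rewrite -pE; exact: Cayley_Hamilton.
have trh p j : \tr (h p * x ^+ j.+1) = 0.
  elim/poly_ind: p j => [|p c IH] j; first by rewrite /h rmorph0 mul0r mxtrace0.
  rewrite /h rmorphD rmorphM /= horner_mx_C horner_mx_X -/h mulrDl mxtraceD -mulrA -exprS IH.
  by rewrite add0r -mulmxE mul_scalar_mx mxtraceZ tr0 mulr0.
have hE : h (u * 'X ^+ k.+1) + h (v * q) = 1 by rewrite /h -rmorphD uv rmorph1.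
have E0 : h (u * 'X ^+ k.+1) = 0.
  apply: idempotent_trace0.
    have -> : h (u * 'X ^+ k.+1) *m h (u * 'X ^+ k.+1) =
        h (u * 'X ^+ k.+1) - h (u * 'X ^+ k.+1) * h (v * q).
      by rewrite mulmxE -[X in X - _]mulr1 -hE mulrDr addrK.
    rewrite /h -rmorphM /= (_ : _ * (v * q) = (u * 'X * v) * (q * 'X ^+ k)).
      by rewrite (rmorphM _ (u * 'X * v)) /= -/h CH mulr0 subr0.
    by rewrite exprS; ring.
  by rewrite /h rmorphM rmorphXn /= horner_mx_X.
have xk : x ^+ k = 0.
  move: hE; rewrite E0 add0r /h rmorphM /= -/h => vq.
  have qk : h q * x ^+ k = 0 by rewrite -CH /h rmorphM rmorphXn /= horner_mx_X.
  by rewrite -[_ ^+ k]mul1r -vq -mulrA qk mulr0.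
have kn : (k <= n.+1)%N.
  have qn0 : q != 0 by apply: contra_neq p0 => q00; rewrite pE q00 mul0r.
  rewrite -ltnS -(size_char_poly x) pE size_Mmonic ?monicXn // size_polyXn addnS /=.
  by rewrite -[X in (X < _)%N]add0n ltn_add2r size_poly_gt0.
by have := exprD x (n.+1 - k) k; rewrite subnK // xk mulr0.
Qed.

(** * Traces of words *)

Definition mxword (R : realType) n f (A : 'I_f -> 'M[R]_n.+1) (w : seq 'I_f) : 'M[R]_n.+1 :=
  \prod_(i <- w) A i.

(** The empty word is left out: its trace is the matrix size and never vanishes. *)
Definition short_words f k : seq (seq 'I_f) :=
  [seq w <- [seq val b | b <- enum {: k.-bseq 'I_f}] | (0 < size w)%N].

Lemma mem_short_words f k (w : seq 'I_f) :
  (w \in short_words f k) = (0 < size w <= k)%N.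
Proof.
rewrite mem_filter; congr (_ && _); apply/mapP/idP => [[b _ ->]|wk].
  exact: size_bseq.
by exists (Bseq wk) => //; rewrite mem_enum.
Qed.

Lemma span_induction (K : fieldType) (vT : vectType K) (P : vT -> Prop) (s : seq vT) :
  P 0 -> (forall x y, P x -> P y -> P (x + y)) -> (forall c x, P x -> P (c *: x)) ->
  (forall x, x \in s -> P x) -> forall v, v \in <<s>>%VS -> P v.
Proof.
move=> P0 PD PZ Ps v /(coord_span (X := in_tuple s)) ->.
by apply: (big_ind P) => // i _; apply: PZ; apply: Ps; rewrite mem_nth.
Qed.

Section WordSpan.
Variables (R : realType) (n f : nat) (A : 'I_f -> 'M[R]_n.+1).
Local Notation M := 'M[R]_n.+1.
Local Notation word := (mxword A).

Definition word_span k : {vspace M} := <<[seq word w | w <- short_words f k]>>%VS.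

Lemma mxword_cat u v : word (u ++ v) = word u * word v.
Proof. exact: big_cat. Qed.

Lemma mem_word_span k w : (0 < size w <= k)%N -> word w \in word_span k.
Proof. by move=> wk; apply: memv_span; apply: map_f; rewrite mem_short_words. Qed.

Lemma word_span_ind k (P : M -> Prop) : P 0 -> (forall x y, P x -> P y -> P (x + y)) ->
  (forall c x, P x -> P (c *: x)) -> (forall w, (0 < size w <= k)%N -> P (word w)) ->
  forall x, x \in word_span k -> P x.
Proof.
move=> P0 PD PZ Pw; apply: span_induction => // x /mapP[w]; rewrite mem_short_words.
by move=> wk ->; apply: Pw.
Qed.

Lemma word_span_leq j k : (j <= k)%N -> (word_span j <= word_span k)%VS.
Proof.
move=> jk; apply/subvP; apply: word_span_ind => [|x y|c x|w /andP[w0 wj]].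
- exact: mem0v.
- exact: memvD.
- exact: memvZ.
- by apply: mem_word_span; rewrite w0 (leq_trans wj).
Qed.

Lemma mul_word_span j k x y : x \in word_span j -> y \in word_span k ->
  x * y \in word_span (j + k).
Proof.
move=> xj yk; move: x xj; apply: word_span_ind => [|x x' hx hx'|c x hx|w /andP[w0 wj]].
- by rewrite mul0r mem0v.
- by rewrite mulrDl memvD.
- by rewrite -scalerAl memvZ.
move: y yk; apply: word_span_ind => [|y y' hy hy'|c y hy|v /andP[v0 vk]].
- by rewrite mulr0 mem0v.
- by rewrite mulrDr memvD.
- by rewrite -scalerAr memvZ.
- by rewrite -mxword_cat mem_word_span // size_cat addn_gt0 w0 leq_add.
Qed.

Lemma word_span_stable k w : (0 < k)%N -> word_span k.+1 = word_span k ->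
  (0 < size w)%N -> word w \in word_span k.
Proof.
move=> k0 kE; elim: w => // i w IH _.
have Ai : A i \in word_span 1.
  by have := @mem_word_span 1 [:: i] isT; rewrite /mxword big_seq1.
case: w IH => [|j w] IH.
  by rewrite /mxword big_seq1; exact: (subvP (word_span_leq k0) _ Ai).
have := mul_word_span Ai (IH isT); rewrite add1n kE.
by rewrite [in X in _ -> X]/mxword [in X in _ -> X]big_cons.
Qed.

Lemma word_span_trace k x : (forall w, (0 < size w <= k)%N -> \tr (word w) = 0) ->
  x \in word_span k -> \tr x = 0.
Proof.
move=> tr0 xk; move: x xk; apply: (@word_span_ind k (fun x : M => \tr x = 0)) => //.
- exact: mxtrace0.
- by move=> y z y0 z0; rewrite mxtraceD y0 z0 addr0.
- by move=> c y y0; rewrite mxtraceZ y0 mulr0.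
Qed.

(* The trace form [tr (x y)] becomes positive definite after transposing one
   argument. *)
Lemma trace_orthogonal_dim (U V : {vspace M}) :
  (forall x y, x \in U -> y \in V -> \tr (x * y) = 0) ->
  (\dim U + \dim V <= n.+1 * n.+1)%N.
Proof.
move=> UV; pose T : 'End(M) := linfun (@trmx R n.+1 n.+1).
have TE x : T x = x^T by rewrite lfunE.
have kT : lker T == 0%VS.
  by apply/lker0P => x y; rewrite !TE; exact: trmx_inj.
have <- : \dim (T @: V)%VS = \dim V by rewrite limg_dim_eq // (eqP kT) capv0.
have UT : (U :&: (T @: V) = 0)%VS.
  apply/eqP; rewrite -subv0; apply/subvP => x; rewrite memv_cap memv0.
  move=> /andP[xU /memv_imgP[y yV xE]].
  have := UV _ _ xU yV; rewrite (_ : y = x^T); last by rewrite xE TE trmxK.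
  move=> fx; apply/eqP/matrixP => i j; rewrite mxE.
  have : frob x = 0 by [].
  rewrite frobE => /psumr_eq0P; move=> /(_ (fun i _ => sumr_ge0 _ (fun j _ => sqr_ge0 _))) /(_ i isT).
  by move/psumr_eq0P => /(_ (fun j _ => sqr_ge0 _)) /(_ j isT) /eqP; rewrite sqrf_eq0 => /eqP.
rewrite -dimv_disjoint_sum // -[X in (_ <= X)%N](dim_matrix R n.+1 n.+1) -dimvf.
exact: dimvS (subvf _).
Qed.

Lemma word_span_dim_lt k : (word_span k.+1 != word_span k) ->
  (\dim (word_span k) < \dim (word_span k.+1))%N.
Proof.
move=> kE; have [le eq] := dimv_leqif_eq (word_span_leq (leqnSn k)).
by rewrite ltn_neqAle le eq eq_sym kE.
Qed.

(** The degenerate start of the dimension count. All words are multiples of powers of one matrix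
    [B], and [B] times its Cayley-Hamilton relation involves only positive powers. *)
Lemma word_span_line_stable : (\dim (word_span 1) <= 1)%N ->
  word_span n.+2 = word_span n.+1.
Proof.
move=> d1; apply/eqP; rewrite eqEsubv [X in _ && X]word_span_leq // andbT.
have [B BE] : exists B : M, (word_span 1 = <[B]>)%VS.
  move: d1; rewrite leq_eqVlt => /orP[|]; last first.
    by rewrite ltnS leqn0 dimv_eq0 => /eqP ->; exists 0; apply/esym/eqP; rewrite -dimv_eq0 dim_vline eqxx.
  move=> /eqP d1; exists (vpick (word_span 1)); apply/eqP.
  by rewrite eq_sym eqEdim -memvE memv_pick dim_vline vpick0 -dimv_eq0 d1.
have Bk j : B ^+ j.+1 \in word_span j.+1.
  elim: j => [|j IH]; first by rewrite expr1 BE memv_line.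
  by rewrite exprS; apply: (@mul_word_span 1 j.+1 B _ _ IH); rewrite BE memv_line.
have wB w : exists c : R, word w = c *: B ^+ size w.
  elim: w => [|i w [c wE]]; first by exists 1; rewrite /mxword big_nil scale1r.
  have : A i \in word_span 1.
    by have := @mem_word_span 1 [:: i] isT; rewrite /mxword big_seq1.
  rewrite BE => /vlineP[b Ab]; exists (b * c).
  rewrite /mxword big_cons -/(word w) wE Ab /= exprS.
  by rewrite -scalerAl -scalerAr scalerA.
have CH : B ^+ n.+2 \in word_span n.+1.
  have := Cayley_Hamilton B; have := char_poly_monic B.
  rewrite monicE /lead_coef size_char_poly /= => /eqP p1.
  rewrite -[char_poly B]coefK poly_def size_char_poly rmorph_sum /= big_ord_recr /=.
  rewrite p1 scale1r rmorphXn /= horner_mx_X => /eqP; rewrite addrC addr_eq0 => /eqP Bn.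
  rewrite exprS Bn mulrN mulr_sumr memvN; apply: memv_suml => i _.
  rewrite linearZ /= rmorphXn /= horner_mx_X -scalerAr -exprS memvZ //.
  exact: (subvP (word_span_leq (ltn_ord i)) _ (Bk i)).
apply/subvP; apply: word_span_ind => [|x y|c x|w /andP[w0]].
- exact: mem0v.
- exact: memvD.
- exact: memvZ.
rewrite leq_eqVlt ltnS => /orP[/eqP wn|wn]; last by apply: mem_word_span; rewrite w0.
by have [c ->] := wB w; rewrite wn memvZ.
Qed.

End WordSpan.

Lemma sqr_lt_exp2 d : (d * d < 2 ^ d + 2)%N.
Proof.
suff h k : ((k + 4) * (k + 4) <= 2 ^ (k + 4))%N.
  have [d4|] := leqP 4 d; first by have := h (d - 4)%N; rewrite subnK //; lia.
  by move: d => [|[|[|[|]]]].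
elim: k => // k IH; rewrite addSn expnS; move: (2 ^ _)%N IH => e IH; nia.
Qed.

Section WordsVanish.
Variables (R : realType) (n f : nat) (A : 'I_f -> 'M[R]_n.+2).
Let N := (2 ^ n.+2 - 1)%N.
Hypothesis tr0 : forall w, (0 < size w <= N)%N -> \tr (mxword A w) = 0.

(** Otherwise the spans grow from dimension at least 2 at length 1 to at least [N] at length
    [N - 1]. The last one is trace-orthogonal to the span of [1] and the letters, of dimension at
    least 3, but [N + 3 = 2^d + 2 > d^2] for matrices of size [d]. *)
Lemma word_span_stabilizes : exists2 k, (0 < k <= N)%N &
  word_span A k.+1 = word_span A k.
Proof.
have dN : (n.+2 <= N)%N by rewrite -ltnS /N subn1 prednK ?expn_gt0 // ltn_expl.
have [d1|d2] := leqP (\dim (word_span A 1)) 1.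
  by exists n.+2; [rewrite dN | exact: word_span_line_stable].
have [/existsP[k /eqP kE]|] := boolP [exists k : 'I_(N - 2), word_span A k.+2 == word_span A k.+1].
  by exists k.+1 => //=; rewrite (leq_trans (ltn_ord k)) // leq_subr.
rewrite negb_exists => /forallP nst; exfalso.
have N3 : (3 <= N)%N.
  by rewrite /N leq_subRL ?expn_gt0 // (@leq_exp2l 2 2).
have grow k : (k <= N - 2)%N -> (k + 2 <= \dim (word_span A k.+1))%N.
  elim: k => // k IH kN; rewrite addSn; apply: leq_ltn_trans (IH (ltnW kN)) _.
  exact: word_span_dim_lt (nst (Ordinal kN)).
have tr1 x : x \in word_span A 1 -> \tr x = 0.
  apply: word_span_trace => w /andP[w0 w1]; apply: tr0; rewrite w0 (leq_trans w1) //.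
  exact: ltnW (ltnW N3).
have N1 : (N - 2).+1 = (N - 1)%N by rewrite -subSn ?subSS // ltnW.
have N1' : (1 + (N - 2).+1 = N)%N by rewrite N1 subnKC // ltnW // ltnW.
(* A word of length at most [N - 1] times a letter is still a short word, hence traceless. *)
have orth x y : x \in word_span A (N - 2).+1 -> y \in (word_span A 1 + <[1 : 'M[R]_n.+2]>)%VS ->
    \tr (x * y) = 0.
  move=> xL /memv_addP[y1 y1L [_ /vlineP[c ->] ->]].
  rewrite mulrDr mxtraceD -scalerAr mulr1 mxtraceZ -mulmxE mxtrace_mulC.
  have -> : \tr x = 0.
    apply: word_span_trace xL => w /andP[w0 w1]; apply: tr0.
    by rewrite w0 (leq_trans w1) // -[X in (_ <= X)%N]N1' leq_addl.
  have := mul_word_span y1L xL; rewrite N1' mulr0 addr0; exact: word_span_trace.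
have := trace_orthogonal_dim orth; rewrite dimv_disjoint_sum; last first.
  apply/eqP; rewrite -subv0; apply/subvP => x; rewrite memv_cap memv0 => /andP[/tr1 x0 /vlineP[c xE]].
  move: x0; rewrite xE mxtraceZ -[1]/(1%:M) mxtrace1 => /eqP.
  by rewrite mulf_eq0 pnatr_eq0 orbF => /eqP ->; rewrite scale0r.
rewrite dim_vline oner_eq0 /=; apply/negP; rewrite -ltnNge.
apply: leq_trans (leq_add (grow _ (leqnn _)) (leq_add d2 (leqnn 1))).
rewrite subnK ?(ltnW N3) //; apply: leq_trans (sqr_lt_exp2 _) _.
by rewrite /N; lia.
Qed.

Theorem mxword_eq0 w : size w = N -> mxword A w = 0.
Proof.
move=> wN; have [k /andP[k0 kN] kE] := word_span_stabilizes.
have trk x : x \in word_span A k -> \tr x = 0.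
  apply: word_span_trace => v /andP[v0 vk]; apply: tr0.
  by rewrite v0 (leq_trans vk).
have SM x y : x \in word_span A k -> y \in word_span A k -> x * y \in word_span A k.
  move=> xk; move: y; apply: word_span_ind => [|y z hy hz|c y hy|u /andP[u0 uk]].
  - by rewrite mulr0 mem0v.
  - by rewrite mulrDr memvD.
  - by rewrite -scalerAr memvZ.
  move: x xk; apply: word_span_ind => [|y z hy hz|c y hy|v /andP[v0 vk]].
  - by rewrite mul0r mem0v.
  - by rewrite mulrDl memvD.
  - by rewrite -scalerAl memvZ.
  by rewrite -mxword_cat word_span_stable // size_cat addn_gt0 v0.
pose S x := x \in word_span A k; pose J (x : 'M[R]_n.+2) := x = 0.
have SA : subalgebra S.
  by split; [exact: mem0v | move=> x y; exact: memvD | move=> c x; exact: memvZ | exact: SM].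
have JI : ideal_of S J.
  rewrite /J; split=> [x ->|//|x y -> ->|c x ->|x y _ ->]; first exact: mem0v.
  - by rewrite addr0.
  - by rewrite scaler0.
  - by rewrite mulr0 mul0r.
have nil x : S x -> J (x ^+ n.+2).
  move=> Sx; apply: nilpotent_trace0 => j; apply: trk.
  exact: (subalgebraX j SA Sx).
have := @nagata_higman _ _ n.+1 S J [seq A i | i <- w] SA JI nil.
rewrite size_map /J big_map; apply => // _ /mapP[i _ ->].
have : mxword A [:: i] \in word_span A k by apply: mem_word_span.
by rewrite /mxword big_seq1.
Qed.

End WordsVanish.

(** * Conjugating a nilpotent tuple towards 0 *)

Section ConjugationBySquareSums.
Variables (R : realType) (n f : nat) (A : 'I_f -> 'M[R]_n.+1).
Local Notation M := 'M[R]_n.+1.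

(** Its [k]-th iterate at [1] is the sum of [w^T w] over all words [w] of length [k]. *)
Definition conj_sum (X : M) : M := \sum_i (A i)^T *m X *m A i.

Lemma conj_sumD X Y : conj_sum (X + Y) = conj_sum X + conj_sum Y.
Proof.
by rewrite /conj_sum -big_split; apply: eq_bigr => i _; rewrite mulmxDr mulmxDl.
Qed.

Lemma conj_sumZ c X : conj_sum (c *: X) = c *: conj_sum X.
Proof.
by rewrite /conj_sum scaler_sumr; apply: eq_bigr => i _; rewrite -scalemxAr -scalemxAl.
Qed.

Lemma conj_sum_sum (I : Type) (r : seq I) (F : I -> M) :
  conj_sum (\sum_(k <- r) F k) = \sum_(k <- r) conj_sum (F k).
Proof.
apply: (big_morph conj_sum conj_sumD).
by rewrite /conj_sum big1 // => i _; rewrite mulmx0 mul0mx.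
Qed.

Lemma iter_conj_sumT k : (iter k conj_sum 1%:M)^T = iter k conj_sum 1%:M.
Proof.
elim: k => [|k IH]; first by rewrite trmx1.
rewrite iterS {1}/conj_sum linear_sum /=; apply: eq_bigr => i _.
by rewrite !trmx_mul trmxK IH mulmxA.
Qed.

Lemma iter_conj_sum_ge0 k (v : 'rV[R]_n.+1) :
  0 <= (v *m iter k conj_sum 1%:M *m v^T) 0 0.
Proof.
elim: k v => [|k IH] v.
  have [->|v0] := eqVneq v 0; first by rewrite !mul0mx mxE.
  by rewrite mulmx1 ltW // rV_sqr_gt0.
rewrite iterS /conj_sum mulmx_sumr mulmx_suml summxE; apply: sumr_ge0 => i _.
by have := IH (v *m (A i)^T); rewrite trmx_mul trmxK !mulmxA.
Qed.

Lemma iter_conj_sum_eq0 k (Z : M) : (forall w, size w = k -> mxword A w *m Z = 0) ->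
  Z^T *m iter k conj_sum 1%:M *m Z = 0.
Proof.
elim: k Z => [|k IH] Z wZ.
  by have := wZ [::] erefl; rewrite /mxword big_nil mul1mx => ->; rewrite mulmx0.
rewrite iterS /conj_sum mulmx_sumr mulmx_suml big1 // => i _.
have := IH (A i *m Z); rewrite trmx_mul !mulmxA; apply=> w wk.
have := wZ (rcons w i); rewrite size_rcons wk => /(_ erefl).
by rewrite /mxword -cats1 big_cat big_seq1 /= -mulmxA.
Qed.

(* The quadratic form [\sum_(|w| <= m) s^|w| w^T w] is contracted by [1 / s]. *)
Lemma nilpotent_conj_small m (e : R) : 0 < e ->
  (forall w, size w = m.+1 -> mxword A w = 0) ->
  exists2 g, g \in unitmx & \sum_i frob (g *m A i *m invmx g) < e.
Proof.
(* The words of length [m + 1] vanish, so [s conj_sum Q = Q - 1]. With [Q = h h^T] the conjugated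
   tuple then has squared norm [(n + 1 - frob (h^-1)) / s], which is below [e] for this [s]. *)
move=> e0 w0; pose s : R := n.+2%:R / e.
have s0 : 0 < s by rewrite divr_gt0 ?ltr0n.
pose T k := iter k conj_sum 1%:M.
pose Q : M := \sum_(k < m.+1) s ^+ k *: T k.
have Tm : T m.+1 = 0.
  have := @iter_conj_sum_eq0 m.+1 1%:M; rewrite trmx1 mul1mx mulmx1; apply=> w /w0 ->.
  by rewrite mul0mx.
have QE : s *: conj_sum Q = Q - 1%:M.
  have -> : Q - 1%:M = \sum_(k < m) s ^+ k.+1 *: T k.+1.
    by rewrite /Q big_ord_recl expr0 scale1r addrAC subrr add0r.
  rewrite /Q conj_sum_sum scaler_sumr big_ord_recr /= conj_sumZ.
  rewrite -[conj_sum _]/(T m.+1) Tm !scaler0 addr0.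
  by apply: eq_bigr => i _; rewrite conj_sumZ scalerA -exprS.
have [U UU [x Qx]] : exists2 U, orthogonal U & exists x, Q = U *m expmx_diag x *m U^T.
  apply: posdef_spectral => [|v v0].
    rewrite /Q linear_sum /=; apply: eq_bigr => i _.
    by rewrite linearZ /= iter_conj_sumT.
  rewrite /Q mulmx_sumr mulmx_suml summxE big_ord_recl /= expr0 scale1r mulmx1.
  apply: ltr_pwDl; first exact: rV_sqr_gt0.
  apply: sumr_ge0 => i _; rewrite -scalemxAr -scalemxAl [X in 0 <= X]mxE.
  by apply: mulr_ge0; [exact: exprn_ge0 (ltW s0) | exact: (iter_conj_sum_ge0 i.+1 v)].
have [h hu Qh] := gram_expmx_diag x (orthogonal_unit UU).
have hTu : h^T \in unitmx by rewrite unitmx_tr.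
exists h^T => //.
have -> : \sum_i frob (h^T *m A i *m invmx h^T) = \tr (invmx h *m conj_sum Q *m (invmx h)^T).
  rewrite /conj_sum mulmx_sumr mulmx_suml linear_sum /=; apply: eq_bigr => i _.
  rewrite /frob mxtrace_mulC !trmx_mul trmxK -!trmx_inv trmxK Qx Qh !mulmxA //.
have -> : conj_sum Q = s^-1 *: (Q - 1%:M) by rewrite -QE scalerA mulVf ?scale1r ?gt_eqF.
rewrite -scalemxAr -scalemxAl mxtraceZ mulmxBr mulmxBl mulmx1 Qx Qh.
rewrite !mulmxA mulVmx // mul1mx -trmx_mul mulVmx // trmx1 linearB /= mxtrace1.
rewrite -/(frob _) /s invf_div -ltr_pdivlMl ?divr_gt0 ?ltr0n //.
rewrite invf_div mulfVK ?gt_eqF //.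
have := frob_ge0 (invmx h).
have : n.+1%:R < n.+2%:R :> R by rewrite ltr_nat.
move: (frob _) n.+1%:R n.+2%:R => F a b ab F0.
lra.
Qed.

End ConjugationBySquareSums.

(** * Compactness: from vanishing traces to small traces *)

Section Compactness.
Variables (R : realType) (n f : nat).
Local Notation m := (f * (n.+2 * n.+2))%N.
Local Notation M := 'M[R]_n.+2.

Definition tuple_of_row (v : 'rV[R]_m) (i : 'I_f) : M :=
  vec_mx (row i (vec_mx v : 'M_(f, n.+2 * n.+2))).

Lemma tuple_of_rowE v i a b :
  tuple_of_row v i a b = v 0 (mxvec_index i (mxvec_index a b)).
Proof. by rewrite !mxE. Qed.

Lemma tuple_of_row_surj (A : 'I_f -> M) : exists v, tuple_of_row v =1 A.
Proof.
exists (mxvec (\matrix_i mxvec (A i))) => i.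
by rewrite /tuple_of_row mxvecK rowK mxvecK.
Qed.

Lemma continuous_fsum (I : Type) (r : seq I) (F : I -> 'rV[R]_m -> R) :
  (forall i, continuous (F i)) -> continuous (fun v => \sum_(i <- r) F i v).
Proof.
move=> FC; elim: r => [|i r IH].
  rewrite (_ : (fun v => _) = (fun=> 0)); first exact: cst_continuous.
  by apply/funext => v; rewrite big_nil.
rewrite (_ : (fun v => _) = (fun v => F i v + \sum_(j <- r) F j v)).
  by move=> v; exact: (cvgD (FC i v) (IH v)).
by apply/funext => v; rewrite big_cons.
Qed.

Lemma continuous_mulmx (F G : 'rV[R]_m -> M) :
  (forall a b, continuous (fun v => F v a b)) -> (forall a b, continuous (fun v => G v a b)) ->
  forall a b, continuous (fun v => (F v *m G v) a b).
Proof.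
move=> FC GC a b; under eq_fun do rewrite mxE.
by apply: continuous_fsum => c v; exact: (cvgM (FC a c v) (GC c b v)).
Qed.

Lemma continuous_tuple_of_row i a b : continuous (fun v => tuple_of_row v i a b).
Proof. by under eq_fun do rewrite tuple_of_rowE; exact: coord_continuous. Qed.

Lemma continuous_mxword w a b : continuous (fun v => mxword (tuple_of_row v) w a b).
Proof.
elim: w a b => [|i w IH] a b.
  rewrite (_ : (fun v => _) = (fun=> (1 : M) a b)); first exact: cst_continuous.
  by apply/funext => v; rewrite /mxword big_nil.
rewrite (_ : (fun v => _) = (fun v => (tuple_of_row v i *m mxword (tuple_of_row v) w) a b)).
  2: by apply/funext => v; rewrite /mxword big_cons.
by apply: continuous_mulmx => // *; exact: continuous_tuple_of_row.
Qed.

Lemma continuous_mxword_trace w : continuous (fun v => \tr (mxword (tuple_of_row v) w)).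
Proof. by apply: continuous_fsum => i; exact: continuous_mxword. Qed.

Lemma continuous_conj_frob (g h : M) :
  continuous (fun v : 'rV[R]_m => \sum_i frob (g *m tuple_of_row v i *m h)).
Proof.
apply: continuous_fsum => i; under eq_fun do rewrite frobE.
apply: continuous_fsum => a; apply: continuous_fsum => b.
have c : continuous (fun v => (g *m tuple_of_row v i *m h) a b).
  apply: continuous_mulmx => [|? ?]; last exact: cst_continuous.
  apply: continuous_mulmx => [? ?|]; first exact: cst_continuous.
  exact: continuous_tuple_of_row.
rewrite (_ : (fun v => _) = (fun v => (g *m tuple_of_row v i *m h) a b * (g *m tuple_of_row v i *m h) a b)).
  by move=> v; exact: (cvgM (c v) (c v)).
by apply/funext => v; rewrite expr2.
Qed.

Let N := (2 ^ n.+2 - 1)%N.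

(** Counterexamples with trace bounds [1 / (k + 1)] lie in a compact box. At a cluster point all
    short words are traceless, so some [g] conjugates it to norm below 1; by continuity the same [g]
    works for a tuple of the sequence. *)
Lemma small_traces_conj_small : exists2 e : R, 0 < e &
  forall A : 'I_f -> M, \sum_i frob (A i) <= 4 ->
    (forall w, (0 < size w <= N)%N -> `|\tr (mxword A w)| <= e) ->
    exists2 g, g \in unitmx & \sum_i frob (g *m A i *m invmx g) < 1.
Proof.
have [//|no] := pselect (exists2 e : R, 0 < e &
  forall A : 'I_f -> M, \sum_i frob (A i) <= 4 ->
    (forall w, (0 < size w <= N)%N -> `|\tr (mxword A w)| <= e) ->
    exists2 g, g \in unitmx & \sum_i frob (g *m A i *m invmx g) < 1).
have bad (k : nat) : exists v : 'rV[R]_m,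
  [/\ \sum_i frob (tuple_of_row v i) <= 4,
      forall w, (0 < size w <= N)%N -> `|\tr (mxword (tuple_of_row v) w)| <= k.+1%:R^-1 &
      forall g, g \in unitmx -> 1 <= \sum_i frob (g *m tuple_of_row v i *m invmx g)].
  apply/not_existsP => H; apply: no; exists k.+1%:R^-1; first by rewrite invr_gt0 ltr0n.
  move=> A A4 Ae; have [v vA] := tuple_of_row_surj A.
  have [//|noG] := pselect (exists2 g, g \in unitmx & \sum_i frob (g *m A i *m invmx g) < 1).
  exfalso; apply: (H v); have -> : tuple_of_row v = A by apply/funext.
  split=> // g gu; rewrite leNgt; apply/negP => g1; apply: noG; by exists g.
have [u uP] := choice bad.
pose K := [set v : 'rV[R]_m | forall j, `[-2, 2]%classic (v ord0 j)]%classic.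
have Kc : compact K.
  exact: (@rV_compact R m (fun=> `[-2, 2]%classic) (fun=> @segment_compact R (-2) 2)).
have uK k : K (u k).
  move=> j; have [u4 _ _] := uP k; rewrite /= in_itv /= -ler_norml -ler_sqr ?nnegrE //.
  rewrite real_normK ?num_real // (_ : 2 ^+ 2 = 4); last by rewrite -natrX.
  apply: le_trans u4; case/mxvec_indexP: j => i j; case/mxvec_indexP: j => a b.
  rewrite -tuple_of_rowE (bigD1 i) //= frobE (bigD1 a) //= (bigD1 b) //= -!addrA lerDl.
  rewrite !addr_ge0 // ?sumr_ge0 // => *; rewrite ?sqr_ge0 ?frob_ge0 ?sumr_ge0 // => *.
  exact: sqr_ge0.
have FK : (u @ \oo)%classic K by exists 0%N => // k _; exact: uK.
have [v [_ vcl]] := Kc _ _ FK.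
have meets (B : set 'rV[R]_m) (k0 : nat) : nbhs v B -> exists2 k, (k0 <= k)%N & B (u k).
  move=> vB; have : (u @ \oo)%classic (u @` [set k | (k0 <= k)%N])%classic.
    by exists k0 => // k /= kk; exists k.
  by move=> /vcl /(_ vB) [_ [[k /= kk <-] Bk]]; exists k.
have v0 w : (0 < size w <= N)%N -> \tr (mxword (tuple_of_row v) w) = 0.
  move=> wN; apply/eqP/negP => /negP t0.
  pose c := `|\tr (mxword (tuple_of_row v) w)|.
  have c0 : 0 < c by rewrite normr_gt0.
  have c2 : 0 < c / 2 by rewrite divr_gt0.
  have /cvgrPdist_lt /(_ _ c2) near_v := @continuous_mxword_trace w v.
  have [k kk /= vu] := meets _ (Num.truncn (2 / c)) near_v.
  have [_ /(_ w wN) uk _] := uP k.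
  have kc : k.+1%:R^-1 < c / 2.
    rewrite -[c / 2]invf_div ltf_pV2 ?posrE ?ltr0n ?divr_gt0 //.
    apply: lt_le_trans (truncnS_gt _) _; by rewrite ler_nat ltnS.
  have := ler_normD (\tr (mxword (tuple_of_row v) w) - \tr (mxword (tuple_of_row (u k)) w))
    (\tr (mxword (tuple_of_row (u k)) w)).
  rewrite subrK -/c => h.
have := lt_trans (le_lt_trans h (ltr_leD vu uk)) (_ : _ < c / 2 + c / 2).
  by rewrite ltrD2l => /(_ kc); rewrite -splitr ltxx.
have [g gu gv] : exists2 g, g \in unitmx &
    \sum_i frob (g *m tuple_of_row v i *m invmx g) < 1.
  have NE : N = (N.-1).+1 by rewrite prednK // /N subn_gt0 (@ltn_exp2l 2 0).
  apply: (@nilpotent_conj_small _ _ _ _ N.-1) => // w; rewrite -NE.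
  exact: mxword_eq0.
have e0 : 0 < 1 - \sum_i frob (g *m tuple_of_row v i *m invmx g) by rewrite subr_gt0.
have /cvgrPdist_lt /(_ _ e0) near_v := @continuous_conj_frob g (invmx g) v.
have [k _ /= vu] := meets _ 0%N near_v.
have [_ _ /(_ g gu)] := uP k; move: vu; rewrite ltr_norml => /andP[h _].
by move=> h1; clear -h h1; lra.
Qed.

End Compactness.

(** * Norm of a suitable conjugate in terms of traces *)

Lemma frob_ge1 (R : realType) n (b : 'M[R]_n.+1) : \det b = 1 -> 1 <= frob b.
Proof.
move=> db; have bu : b \in unitmx by rewrite unitmxE db unitr1.
have [y] := relative_log_exists (unitmx1 R n.+1) bu; rewrite trmx1 mulmx1.
by move/(relative_log1 db) => [-> /sum_expR_ge1].
Qed.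

Lemma frobZ (R : realType) n (c : R) (X : 'M[R]_n) : frob (c *: X) = c ^+ 2 * frob X.
Proof.
rewrite !frobE mulr_sumr; apply: eq_bigr => i _; rewrite mulr_sumr.
by apply: eq_bigr => j _; rewrite mxE exprMn.
Qed.

Lemma mxword_conj (R : realType) n f (A : 'I_f -> 'M[R]_n.+1) (c : R) g w :
  g \in unitmx ->
  mxword (fun i => c *: (g *m A i *m invmx g)) w =
  c ^+ size w *: (g *m mxword A w *m invmx g).
Proof.
move=> gu; elim: w => [|i w IH].
  by rewrite /mxword !big_nil mulmx1 mulmxV // scale1r.
rewrite /mxword !big_cons -!/(mxword _ _) IH -!mulmxE exprS.
rewrite -scalemxAl -scalemxAr scalerA; congr (_ *: _).
by rewrite !mulmxA mulmxKV.
Qed.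

(* Otherwise an almost minimal conjugate, rescaled to norm between 1 and 2,
   contradicts compactness. *)
Lemma traces_control (R : realType) n f : exists2 C : R, 0 < C &
  forall (A : 'I_f -> 'M[R]_n.+2) tau, 0 < tau ->
    (forall w, (0 < size w <= 2 ^ n.+2 - 1)%N -> `|\tr (mxword A w)| <= tau ^+ size w) ->
    exists2 g, g \in unitmx & \sum_i frob (g *m A i *m invmx g) <= C * tau ^+ 2.
Proof.
have [e0 e0_gt0 small] := small_traces_conj_small R n f.
pose e := Num.min e0 1.
have e_gt0 : 0 < e by rewrite lt_min e0_gt0 ltr01.
have ee0 : e <= e0 by rewrite ge_min lexx.
have e1 : e <= 1 by rewrite ge_min lexx orbT.
(* Large enough that [inf D >= C tau^2] forces [tau / mu <= e] for [mu] the square root of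
   [inf D]. *)
pose C := 4 / e ^+ 2; have C0 : 0 < C by rewrite divr_gt0 ?exprn_gt0.
exists C => // A tau tau0 Atau.
pose phi g := \sum_i frob (g *m A i *m invmx g).
have phi0 g : 0 <= phi g by apply: sumr_ge0 => i _; exact: frob_ge0.
pose D : set R := fun s => exists2 g, g \in unitmx & s = phi g.
have Dinf : has_inf D.
  split; first by exists (phi 1%:M), 1%:M; rewrite ?unitmx1.
  by exists 0 => _ [g _ ->].
have Dle g : g \in unitmx -> inf D <= phi g.
  by move=> gu; apply: ge_inf; [exact: Dinf.2 | exists g].
have near_inf s : inf D < s -> exists2 g, g \in unitmx & phi g < s.
  rewrite -subr_gt0 => s0; have [_ [g gu ->] gs] := inf_adherent s0 Dinf.
  by exists g => //; move: gs; rewrite addrC subrK.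
have [/near_inf[g gu gC]|CI] := ltP (inf D) (C * tau ^+ 2).
  by exists g => //; exact: ltW.
have I0 : 0 < inf D by apply: lt_le_trans CI; rewrite mulr_gt0 ?exprn_gt0.
have [g0 g0u g04] : exists2 g, g \in unitmx & phi g < 4 * inf D by apply: near_inf; lra.
pose mu := Num.sqrt (inf D); have mu0 : 0 < mu by rewrite sqrtr_gt0.
have mu2 : mu ^+ 2 = inf D by rewrite sqr_sqrtr // ltW.
pose B i := mu^-1 *: (g0 *m A i *m invmx g0).
have taumu : tau / mu <= e.
  have emu0 : 0 <= e * mu by rewrite mulr_ge0 // ltW.
  rewrite ler_pdivrMr // -ler_sqr ?nnegrE ?(ltW tau0) //.
  rewrite exprMn mu2; apply: (@le_trans _ _ (e ^+ 2 * (C * tau ^+ 2))); last first.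
    by rewrite ler_wpM2l ?exprn_ge0 // ltW.
  rewrite (_ : e ^+ 2 * _ = 4 * tau ^+ 2); last by rewrite /C; field; exact: lt0r_neq0.
  by rewrite ler_peMl ?sqr_ge0 // ler1n.
have taumu0 : 0 <= tau / mu by rewrite divr_ge0 ?ltW.
have B4 : \sum_i frob (B i) <= 4.
  under eq_bigr do rewrite frobZ.
  by rewrite -mulr_sumr exprVn mu2 mulrC ler_pdivrMr // ltW.
have Be w : (0 < size w <= 2 ^ n.+2 - 1)%N -> `|\tr (mxword B w)| <= e0.
  move=> wN; rewrite mxword_conj // mxtraceZ mxtrace_mulC mulmxA mulVmx // mul1mx.
  have mui k : 0 <= mu^-1 ^+ k by rewrite exprn_ge0 // invr_ge0 ltW.
  rewrite normrM ger0_norm //.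
  apply: (@le_trans _ _ ((tau / mu) ^+ size w)).
    by rewrite exprMn mulrC ler_wpM2r // Atau.
  apply: (le_trans _ ee0); apply: (le_trans _ taumu); move: wN => /andP[].
  by case: (size w) => // k _ _; rewrite exprS ler_piMr // exprn_ile1 // (le_trans taumu).
have [g gu g1] := small B B4 Be; exfalso.
have ggu : g *m g0 \in unitmx by rewrite unitmx_mul gu.
have := Dle _ ggu; apply/negP; rewrite -ltNge; move: g1.
have -> : \sum_i frob (g *m B i *m invmx g) = (inf D)^-1 * phi (g *m g0).
  rewrite /phi mulr_sumr; apply: eq_bigr => i _.
  have -> : invmx (g *m g0) = invmx g0 *m invmx g.
    rewrite -[LHS]mul1mx -(mulmx1C (_ : g *m g0 *m (invmx g0 *m invmx g) = 1%:M)).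
      by rewrite -mulmxA mulmxV ?mulmx1.
    by rewrite !mulmxA mulmxK // mulmxV.
  by rewrite /B -scalemxAr -scalemxAl frobZ exprVn mu2 !mulmxA.
by rewrite mulrC ltr_pdivrMr // mul1r.
Qed.

(** * The trace sum *)

Lemma lcm_upto_gt0 N : (0 < lcm_upto N)%N.
Proof.
rewrite /lcm_upto; elim: N => [|N IH]; first by rewrite big_geq.
by rewrite big_nat_recr //= lcmn_gt0 IH.
Qed.

Lemma dvdn_lcm_upto k N : (0 < k <= N)%N -> (k %| lcm_upto N)%N.
Proof.
move=> /andP[k0 kN]; rewrite /lcm_upto; elim: N kN => [|N IH kN]; first by lia.
rewrite big_nat_recr //=; move: kN; rewrite leq_eqVlt ltnS => /orP[/eqP ->|/IH].
  exact: dvdn_lcmr.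
by move/dvdn_trans; apply; exact: dvdn_lcml.
Qed.

Section GroupWords.
Variables (Gam : groupType) (F : {fset Gam}).

Definition group_word f (gam : 'I_f -> Gam) (w : seq 'I_f) : Gam :=
  foldr (fun i x => gam i * x)%g 1%g w.

Lemma group_word_products f (gam : 'I_f -> Gam) w :
  (forall i, gam i \in F) -> group_word gam w \in products F (size w).
Proof.
move=> gF; elim: w => [|i w IH] /=; first by rewrite inE.
by apply/imfset2P; exists (gam i) => //; exists (group_word gam w).
Qed.

Lemma word_length_le h k : (0 < k)%N -> h \in products F k ->
  (0 < word_length F h <= k)%N.
Proof.
move=> k0 hk; rewrite /word_length; case: pselect => [hP|[]]; last by exists k; rewrite k0.
case: ex_minnP => r /andP[r0 _]; rewrite r0; apply.
by rewrite k0.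
Qed.

Lemma mem_word_ball h k N : (0 < k <= N)%N -> h \in products F k -> h \in word_ball F N.
Proof.
move=> kN hk; apply/bigfcupP; exists k => //.
by rewrite mem_iota andbT; lia.
Qed.

Lemma word_length_ball h N : h \in word_ball F N -> (0 < word_length F h <= N)%N.
Proof.
move/bigfcupP => [r]; rewrite andbT mem_iota => rN /word_length_le; lia.
Qed.

End GroupWords.

(** As [k] divides [m], the exponent [2 m / k] is even, so the bound controls [|x|] and a root can
    be taken. *)
Lemma root_bound (R : realType) (x y : R) (m k : nat) : 0 <= y -> (0 < m)%N -> (0 < k)%N ->
  (k %| m)%N -> x ^+ ((2 * m) %/ k) <= y ^+ (2 * m) -> `|x| <= y ^+ k.
Proof.
move=> y0 m0 k0 km; have [q mE] : exists q, m = (q * k)%N by exists (m %/ k)%N; rewrite divnK.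
have q0 : (0 < q)%N by move: m0; rewrite mE muln_gt0 => /andP[].
rewrite mE mulnA mulnK // [(2 * q * k)%N]mulnC (exprM y) => h.
rewrite -(@ler_pXn2r _ (2 * q)) ?nnegrE ?exprn_ge0 //; last by rewrite muln_gt0.
rewrite -normrX ger0_norm // exprM; exact: (exprn_ge0 _ (sqr_ge0 x)).
Qed.

(** Replacing [K] and [C] by [1 + K] and [1 + C] makes them at least 1, so the constants can be
    absorbed into the outer power [2 n]; [D] turns [1 + T] into a multiple of [T]. *)
Lemma final_bound (R : realType) (n m : nat) (S K C D T tau : R) :
  (0 < n)%N -> 0 <= S -> 0 <= K -> 0 <= C -> 0 <= D -> 0 <= T ->
  S <= K * (C * tau ^+ 2) ^+ n -> tau ^+ (2 * m) = 1 + T -> 1 + T <= D * T ->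
  S ^+ (2 * m) <= ((1 + K) ^+ (2 * m) * (1 + C) ^+ m * D * T) ^+ (2 * n).
Proof.
move=> n0 S0 K0 C0 D0 T0 SK tauT TD.
have S1 : S ^+ (2 * m) <= (K * (C * tau ^+ 2) ^+ n) ^+ (2 * m).
  by rewrite lerXn2r ?nnegrE // (le_trans S0).
apply: (le_trans S1).
have -> : (K * (C * tau ^+ 2) ^+ n) ^+ (2 * m) = K ^+ (2 * m) * ((C ^+ m) * (1 + T)) ^+ (2 * n).
  rewrite -tauT exprMn -exprM; congr (_ * _).
  have -> : C ^+ m * tau ^+ (2 * m) = (C * tau ^+ 2) ^+ m by rewrite exprMn -exprM.
  by rewrite -exprM; congr (_ ^+ _); lia.
have K1 : K ^+ (2 * m) <= ((1 + K) ^+ (2 * m)) ^+ (2 * n).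
  apply: (@le_trans _ _ ((1 + K) ^+ (2 * m))).
    by rewrite lerXn2r ?nnegrE ?addr_ge0 // lerDr.
  rewrite -[leLHS]expr1 ler_weXn2l ?exprn_ege1 ?lerDl //; lia.
rewrite -!mulrA [leRHS]exprMn; apply: ler_pM => //.
- exact: exprn_ge0.
- by rewrite exprn_ge0 // mulr_ge0 ?exprn_ge0 // addr_ge0.
have C1 : C ^+ m <= (1 + C) ^+ m by rewrite lerXn2r ?nnegrE ?addr_ge0 // lerDr.
rewrite lerXn2r ?nnegrE //.
- by rewrite mulr_ge0 ?exprn_ge0 // addr_ge0.
- by rewrite !mulr_ge0 ?exprn_ge0 // addr_ge0.
by apply: ler_pM => //; [exact: exprn_ge0 | rewrite addr_ge0].
Qed.

(** [c1] is fixed before the group [H], so it depends only on the matrix size and the tuple length.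
    [len w] stands for the word length of the group element spelled by [w], possibly shorter than
    [w]. *)
Lemma trace_sum_bound (R : realType) (n f : nat) : (0 < f)%N ->
  exists2 c1 : R, 0 <= c1 &
  forall (H : 'M[R]_n.+2 -> Prop),
    (forall h, H h -> h \in unitmx) -> H 1%:M ->
    (forall h k, H h -> H k -> H (h *m k)) -> (forall h, H h -> H (invmx h)) ->
    (forall h, H h -> H h^T) ->
    (forall U x, orthogonal U -> H (U *m expmx_diag x *m U^T) ->
      forall t, H (U *m expmx_diag (t *: x) *m U^T)) ->
    (forall h, H h -> \det h = 1) ->
  forall A : 'I_f -> 'M[R]_n.+2, (forall i, H (A i)) ->
    (forall h, H h -> \sum_i frob (A i) <= \sum_i frob (h *m A i *m invmx h)) ->
  forall (m : nat) (T : R) (len : seq 'I_f -> nat), m = lcm_upto (2 ^ n.+2 - 1) -> 0 <= T ->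
    (forall w, (0 < size w <= 2 ^ n.+2 - 1)%N ->
      (0 < len w <= size w)%N /\ \tr (mxword A w) ^+ ((2 * m) %/ len w) <= T) ->
  (\sum_i frob (A i)) ^+ (2 * m) <= (c1 * T) ^+ (2 * n.+1).
Proof.
move=> f0; set N := (2 ^ n.+2 - 1)%N; pose m := lcm_upto N.
have m0 : (0 < m)%N := lcm_upto_gt0 N.
have N0 : (0 < N)%N by rewrite /N subn_gt0 (@ltn_exp2l 2 0).
have [C C0 Ctr] := traces_control R n f.
pose K : R := f%:R * (n.+2%:R * expR 3).
have K0 : 0 <= K by rewrite !mulr_ge0 // expR_ge0.
pose tau0 : R := (1 + C)^-1.
have tau00 : 0 < tau0 by rewrite invr_gt0 addr_gt0.
have tau01 : tau0 <= 1 by rewrite invf_le1 ?addr_gt0 // lerDl ltW.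
have Ctau0 : C * tau0 ^+ 2 < 1.
  rewrite /tau0 exprVn ltr_pdivrMr ?exprn_gt0 ?addr_gt0 // mul1r.
  have : 0 <= C ^+ 2 by exact: sqr_ge0.
  by move=> CC; rewrite sqrrD; lra.
(* If [T < c0], each short word has trace at most [(tau0^N)^(len w) <= tau0^(size w)], even when
   [len w = 1]. Some conjugate would then have squared norm below 1, against determinant 1. *)
pose c0 := tau0 ^+ (2 * m * N); have c00 : 0 < c0 by rewrite exprn_gt0.
pose D := 1 + c0^-1; have D0 : 0 <= D by rewrite addr_ge0 // invr_ge0 ltW.
exists ((1 + K) ^+ (2 * m) * (1 + C) ^+ m * D).
  by rewrite !mulr_ge0 ?exprn_ge0 // addr_ge0 // ltW.
move=> H Hunit H1 HM HV HT Hpow Hdet A HA Amin _ T len -> T0 Tw; rewrite -/m in Tw *.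
have len_bound w y : (0 < size w <= N)%N -> 0 <= y -> T <= y ^+ (2 * m) ->
    `|\tr (mxword A w)| <= y ^+ len w.
  move=> wN y0 Ty; have [/andP[l0 lw] trT] := Tw w wN.
  apply: (root_bound y0 m0 l0) => //; last exact: le_trans trT Ty.
  by apply: dvdn_lcm_upto; rewrite l0 (leq_trans lw) //; case/andP: wN.
have c0T : c0 <= T.
  rewrite leNgt; apply/negP => Tc0.
  have small w : (0 < size w <= N)%N -> `|\tr (mxword A w)| <= tau0 ^+ size w.
    move=> wN; have [/andP[l0 lw] _] := Tw w wN.
    apply: (@le_trans _ _ ((tau0 ^+ N) ^+ len w)).
      apply: len_bound => //; first by rewrite exprn_ge0 // ltW.
      by rewrite -exprM mulnC ltW.
    rewrite -exprM; apply: ler_wiXn2l => //; first exact: ltW.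
    by case/andP: wN => _ wN; rewrite (leq_trans wN) // leq_pmulr.
  have [g gu gC] := Ctr A tau0 tau00 small.
  have := le_lt_trans gC Ctau0; apply/negP; rewrite -leNgt.
  pose i0 := Ordinal f0; rewrite (bigD1 i0) //=.
  apply: (@le_trans _ _ (frob (g *m A i0 *m invmx g))).
    apply: frob_ge1; rewrite !det_mulmx (Hdet _ (HA i0)) mulr1 det_inv divff //.
    by rewrite -unitfE -unitmxE.
  by rewrite lerDl; apply: sumr_ge0 => i _; exact: frob_ge0.
(* Adding 1 to [T] ensures [tau >= 1], so a bound with exponent [len w] implies the one with
   exponent [size w]. *)
pose tau := (1 + T) `^ ((2 * m)%:R^-1).
have T1 : 0 < 1 + T by rewrite ltr_pwDl.
have tau0' : 0 < tau by rewrite powR_gt0.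
have tauE : tau ^+ (2 * m) = 1 + T.
  rewrite -powR_mulrn ?powR_ge0 // -powRrM mulVf ?powRr1 ?ltW //.
  by rewrite pnatr_eq0 muln_eq0 -lt0n m0.
have tau1 : 1 <= tau.
  rewrite -(@ler_pXn2r _ (2 * m)) ?nnegrE ?muln_gt0 ?(ltW tau0') //.
  by rewrite expr1n tauE lerDl.
have big w : (0 < size w <= N)%N -> `|\tr (mxword A w)| <= tau ^+ size w.
  move=> wN; have [/andP[l0 lw] _] := Tw w wN.
  apply: (@le_trans _ _ (tau ^+ len w)); last exact: ler_weXn2l.
  by apply: len_bound => //; [exact: ltW | rewrite tauE lerDr].
have [g gu gC] := Ctr A tau tau0' big.
have S0 : 0 <= \sum_i frob (A i) by apply: sumr_ge0 => i _; exact: frob_ge0.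
have TD : 1 + T <= D * T.
  by rewrite /D mulrDl mul1r [leRHS]addrC lerD2r mulrC ler_pdivlMr // mul1r.
have C0' := ltW C0.
apply: (@final_bound _ _ _ _ K C D T tau) => //.
apply: (le_trans (minimal_frob_le Hunit H1 HM HV HT Hpow Hdet HA Amin gu)).
apply: ler_wpM2l => //; rewrite lerXn2r ?nnegrE //.
  by apply: sumr_ge0 => i _; exact: frob_ge0.
by rewrite mulr_ge0 ?sqr_ge0 // ltW.
Qed.

Theorem theorem1p16 (R : realType) (n f : nat) (hn : (1 < n)%N) :
  exists c1 : R,
    forall (G : set 'M[R[i]]_n),
      algebraic_group_in_SL G -> zariski_connected G -> semisimple G ->
      defined_over (@real_algebraic R) G -> transpose_invariant G ->
    forall (Gam : groupType) (F : {fset Gam}),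
      generates F -> #|` F| = f ->
    forall rho : Gam -> 'M[R]_n,
      representation_in G rho ->
      minimal G (fun gam : F => rho (val gam)) ->
      let m := lcm_upto (2 ^ n - 1) in
      let E := word_ball F (2 ^ n - 1) in
      (\sum_(gam <- F) \tr (rho gam *m (rho gam)^T)) ^+ (2 * m)
      <= n%:R ^+ m *
         (c1 * \sum_(h <- E) \tr (rho h) ^+ ((2 * m) %/ word_length F h))
           ^+ (2 * (n - 1)).
Proof.
case: n hn => [|[|n]] // _; set N := (2 ^ n.+2 - 1)%N.
have nm m : 1 <= n.+2%:R ^+ m :> R by rewrite exprn_ege1 // ler1n.
have ev (x : R) k : 0 <= x ^+ (2 * k) by rewrite exprM exprn_ge0 // sqr_ge0.
have m0 := lcm_upto_gt0 N.
(* Without generators the left side is 0, because the exponent [2 m] is positive. *)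
have [->|f0] := posnP f.
  exists 0 => G _ _ _ _ _ Gam F _ /cardfs0_eq -> rho _ _ /=.
  rewrite big_seq_fset0 expr0n muln_eq0 -[lcm_upto _ == _]negbK -lt0n m0 /=.
  by rewrite mulr_ge0 // (le_trans ler01).
have [c1 c10 c1P] := trace_sum_bound R n f0.
exists c1 => G [GG Gz Gdet] _ _ _ Gtr Gam F _ Ff rho [rhoG rho1 rhoM] Amin /=.
pose H := real_points G; have [Gu G1 GM GV] := GG.
have Hdet h : H h -> \det h = 1.
  by move=> /Gdet; rewrite det_map_mx => /(congr1 (@complex.Re R)).
have Hunit h : H h -> h \in unitmx by move=> /Hdet hd; rewrite unitmxE hd unitr1.
have H1 : H 1%:M by rewrite /H /real_points /= map_mx1.
have HM h k : H h -> H k -> H (h *m k) by rewrite /H /real_points /= map_mxM; exact: GM.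
have HV h : H h -> H (invmx h) by rewrite /H /real_points /= map_invmx; exact: GV.
have HT h : H h -> H h^T by rewrite /H /real_points /= -map_trmx; exact: Gtr.
have Hpow U x : orthogonal U -> H (U *m expmx_diag x *m U^T) ->
    forall t, H (U *m expmx_diag (t *: x) *m U^T) by exact: real_points_power.
pose gam (j : 'I_f) : Gam := nth 1%g F j; pose A j := rho (gam j).
have gamF j : gam j \in F by rewrite mem_nth // Ff.
have sumF (P : Gam -> R) : \sum_(g <- F) P g = \sum_j P (gam j).
  by rewrite (big_nth 1%g) Ff big_mkord.
have sumFT (P : Gam -> R) : \sum_(g : F) P (val g) = \sum_j P (gam j).
  by rewrite -sumF big_seq_fsetE.
have HA j : H (A j) by exact: rhoG.
have AminS h : H h -> \sum_i frob (A i) <= \sum_i frob (h *m A i *m invmx h).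
  move=> Hh; have := Amin h Hh; rewrite /tuple_norm ler_sqrt; last first.
    by apply: sumr_ge0 => i _; rewrite mxtrace_mulC; exact: frob_ge0.
  rewrite (sumFT (fun x => \tr ((rho x)^T *m rho x))).
  rewrite (sumFT (fun x => \tr ((h *m rho x *m invmx h)^T *m (h *m rho x *m invmx h)))).
  by under eq_bigr do rewrite mxtrace_mulC; under [leRHS]eq_bigr do rewrite mxtrace_mulC.
set T := \sum_(h <- word_ball F _) _.
have lenP h : h \in word_ball F N -> (0 < word_length F h <= N)%N by exact: word_length_ball.
(* Even exponents make every term of the trace sum nonnegative, so the sum bounds each single
   term. *)
have termE h : h \in word_ball F N -> exists q,
    ((2 * lcm_upto N) %/ word_length F h = 2 * q)%N.
  move=> /lenP /dvdn_lcm_upto /dvdnP[q qE]; exists q.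
  have [l0|l0] := posnP (word_length F h); first by move: m0; rewrite qE l0 muln0.
  by rewrite qE mulnA mulnK.
have T0 : 0 <= T.
  by rewrite /T big_seq; apply: sumr_ge0 => h hE; have [q ->] := termE h hE; exact: ev.
have words w : (0 < size w <= N)%N ->
    (0 < word_length F (group_word gam w) <= size w)%N /\
    \tr (mxword A w) ^+ ((2 * lcm_upto N) %/ word_length F (group_word gam w)) <= T.
  move=> wN; have wp := group_word_products w gamF; have /andP[w0 _] := wN.
  split; first exact: word_length_le.
  have wE := mem_word_ball wN wp.
  have -> : mxword A w = rho (group_word gam w).
    elim: (w) => [|i v IH]; first by rewrite /mxword big_nil /= rho1.
    by rewrite /mxword big_cons -/(mxword A v) IH /= rhoM.
  rewrite /T (big_rem _ wE) /= lerDl big_seq; apply: sumr_ge0 => h hE.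
  by have [q ->] := termE _ (mem_rem hE); exact: ev.
have := c1P H Hunit H1 HM HV HT Hpow Hdet A HA AminS (lcm_upto N) T _ erefl T0 words.
rewrite (sumF (fun g => \tr (rho g *m (rho g)^T))) => /le_trans; apply.
by rewrite subn1 ler_peMl.
Qed.
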